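(* Set $\Delta=6\Delta(K_0)$. Let $0<\epsilon\le\Delta(K_0)$ and $\delta\in(0,1)$ satisfy $\delta\le\Big(\frac{\mu\epsilon}{16G_\Delta d\ell_\Delta}\Big)^2$. Let the stochastic gradient at iteration $t$ be $G_t=G_h^\alpha(K_t)$ (the finite-horizon two-point estimator of the context, with fresh samples at each iteration), with parameters $$\alpha=\min\Big\{r_\Delta,\ \frac{\mu\epsilon}{16G_\Delta L_\Delta}\Big\},\qquad h=\max\left\{1,\ \left\lceil\frac{f_{2\Delta}}{\lambda_{\min}(Q)}\log\max\Big\{\frac{f_{2\Delta}D_X^2}{2\alpha\ell_\Delta},\ \frac{8d f_{2\Delta}D_X^2G_\Delta}{\alpha\mu\epsilon}\Big\}\right\rceil\right\}.$$ Then, with $\varepsilon_h=\frac{d f_{2\Delta}D_X^2}{2\alpha}\big(1-\frac{\lambda_{\min}(Q)}{f_{2\Delta}}\big)^h$, $b=L_\Delta\alpha+\varepsilon_h\le\frac{\mu\epsilon}{8G_\Delta}$, $V_\Delta=4d^2\ell_\Delta^2$ and $M_{\Delta,\delta}=2d\ell_\Delta$, for any $K_t$ with $\Delta(K_t)\le\Delta$ it holds that $$\|\mathbb{E}[G_t|\mathcal{F}_t]-\nabla f(K_t)\|\le b,\quad \mathbb{E}[\|G_t\|^2|\mathcal{F}_t]\le V_\Delta,\quad \mathbb{P}(\|G_t\|\le M_{\Delta,\delta}|\mathcal{F}_t)\ge1-\delta.$$ In addition, define (with $M_{\Delta,\delta}=2d\ell_\Delta$) $$D=\frac{8L_\Delta}{\mu^2}\Big[M_{\Delta,\delta}^2+768(M_{\Delta,\delta}+G_\Delta)^2\log(1/\delta)\Big],\quad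 N=\left\lceil\max\left\{4,\ \frac{2M_{\Delta,\delta}}{\mu r_\Delta},\ \frac{D}{\Delta(K_0)}\right\}\right\rceil,\quad C=2\big(N\Delta(K_0)+D\big),$$ and run SPG for $T$ iterations with stepsizes $\eta_t=\frac{2}{\mu(N+t)}$. If $T\ge\max\{1,\frac{2C}{\epsilon}\}$, then with probability at least $1-2T\delta$ we have $f(K_T)-f^*\le\epsilon$ and $K_t$ is stable for every $0\le t\le T$.
   Context: LQR problem. Let $A\in\mathbb{R}^{n\times n}$, $B\in\mathbb{R}^{n\times m}$, let $Q\in\mathbb{R}^{n\times n}$, $R\in\mathbb{R}^{m\times m}$ be symmetric positive definite, and let $\mathcal{D}$ be a distribution on $\mathbb{R}^n$ with $\mathbb{E}_{x_0\sim\mathcal{D}}[x_0x_0^\top]=I_n$ and $\|x_0\|\le D_X$ for some $D_X>0$. For a policy $K\in\mathbb{R}^{m\times n}$ let $f(K)=\mathbb{E}_{x_0\sim\mathcal{D}}\big[\sum_{i\ge0}(x_i^\top Qx_i+a_i^\top Ra_i)\big]\in[0,+\infty]$, where $x_{i+1}=Ax_i+Ba_i$, $a_i=-Kx_i$. Let $f^*=\min_K f(K)$, assumed finite, $\Delta(K)=f(K)-f^*$, and $f_{\Delta}=f^*+\Delta$ for $\Delta>0$ (so $f_{2\Delta}=f^*+2\Delta$). A policy $K$ is stable if $\rho(A-BK)<1$; this is equivalent to $\Delta(K)<\infty$. $\|\cdot\|$ is the Euclidean norm of vectors and the Frobenius norm of matrices, $\langle\cdot,\cdot\rangle$ the associated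 inner product, and $\lambda_{\min}$ the smallest eigenvalue. SPG. From a fixed stable $K_0$, iterate $K_{t+1}=K_t-\eta_tG_t$. $\mathcal{F}_t$ is the filtration up to iteration $t$, excluding $t$ (so $K_t$ is $\mathcal{F}_t$-measurable). Estimators. Let $d=mn$. For $x\in\mathbb{R}^n$ and integer $h\ge1$ let $x_i=(A-BK)^ix$, $F(K;x)=\sum_{i\ge0}x_i^\top(Q+K^\top RK)x_i$, $F_h(K;x)=\sum_{0\le i<h}x_i^\top(Q+K^\top RK)x_i$. For $\alpha>0$, sample $x_0\sim\mathcal{D}$ and, independently, $U$ uniform on the unit sphere of $\mathbb{R}^{m\times n}$ (at iteration $t$ these samples are independent of $\mathcal{F}_t$), and set $G^\alpha(K)=\frac{d}{2\alpha}\big(F(K+\alpha U;x_0)-F(K-\alpha U;x_0)\big)U$ and $G_h^\alpha(K)=\frac{d}{2\alpha}\big(F_h(K+\alpha U;x_0)-F_h(K-\alpha U;x_0)\big)U$. Constants. $\mu>0$ (independent of $\Delta$) and, for each $\Delta>0$, $L_\Delta,r_\Delta>0$ are fixed constants such that for every $K$ with $\Delta(K)<\Delta$: every $K'$ with $\|K'-K\|\le r_\Delta$ is stable and satisfies $f(K')\le f(K)+\langle\nabla f(K),K'-K\rangle+\frac{L_\Delta}{2}\|K-K'\|^2$; and $\mu\Delta(K)\le\|\nabla f(K)\|^2\le2L_\Delta\Delta(K)$. Put $G_\Delta=2\sqrt{L_\Delta\Delta}$; $r_\Delta$ is chosen small enough that $r_\Delta G_\Delta+\frac{L_\Delta r_\Delta^2}{2}\le\Delta$.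 Moreover $\ell_\Delta>0$ is a constant such that for every $0<\alpha\le r_\Delta$ and every $K$ with $\Delta(K)\le\Delta$ the infinite-horizon estimator satisfies $\|\mathbb{E}[G^\alpha(K)]-\nabla f(K)\|\le L_\Delta\alpha$, $\mathbb{E}[\|G^\alpha(K)\|^2]\le d^2\ell_\Delta^2$, and $\|G^\alpha(K)\|\le d\ell_\Delta$ almost surely. (Such constants are known to exist for LQR.) *)

(* Defs.v *)
From HB Require Import structures.
From mathcomp Require Import all_boot all_order all_algebra.
From mathcomp Require Import all_classical all_reals all_analysis.
From mathcomp Require Import complex.
Set Implicit Arguments.
Unset Strict Implicit.
Unset Printing Implicit Defensive.
Import Order.TTheory GRing.Theory Num.Theory.
Import numFieldNormedType.Exports.
Local Open Scope classical_set_scope.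
Local Open Scope ring_scope.

(* Borel sigma-algebra; 'cV[R]_n and 'M[R]_(m, n) carry the product topology *)
Notation borel_mx R m n := (g_sigma_algebraType (@open 'M[R]_(m, n))).

Section linear_algebra.
Context {R : realType}.

Definition mxdot {m n} (X Y : 'M[R]_(m, n)) : R :=
  \sum_i \sum_j X i j * Y i j.

(* Frobenius norm, and Euclidean norm on column vectors; the norm `|X| provided
   by MathComp-Analysis on matrices is the sup norm. *)
Definition frob {m n} (X : 'M[R]_(m, n)) : R := Num.sqrt (mxdot X X).

Definition qform {n} (M : 'M[R]_n) (x : 'cV[R]_n) : R := (x^T *m M *m x) 0 0.

Definition sym_posdef {n} (M : 'M[R]_n) : Prop :=
  M^T = M /\ forall x : 'cV[R]_n, x != 0 -> 0 < qform M x.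

(* For n > 0 and M symmetric (resp. M arbitrary) the sets below are finite and
   nonempty, so inf is the smallest eigenvalue and sup the largest modulus. *)
Definition lambda_min {n} (M : 'M[R]_n) : R := inf [set a : R | eigenvalue M a].

Definition spectral_radius {n} (M : 'M[R]_n) : R :=
  sup [set ComplexField.Normc.normc z | z in
        [set z : R[i] |
          eigenvalue (map_mx (real_complex R) M) z]].

(* The uniform distribution on the Frobenius unit sphere: the probability carried
   by the sphere and invariant under every orthogonal transformation O of
   R^(m * n), acting on matrices through mxvec. *)
Definition uniform_on_sphere {m n} (s : probability (borel_mx R m n) R) : Prop :=
  s [set u | frob (u : 'M[R]_(m, n)) = 1] = 1%:E /\
  forall O : 'M[R]_(m * n), O *m O^T = 1%:M ->
  forall S : set (borel_mx R m n), measurable S ->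
    s [set u | S (vec_mx (mxvec (u : 'M[R]_(m, n)) *m O))] = s S.

End linear_algebra.

Section conditioning.
Context {R : realType} {d : measure_display} {T : measurableType d}.
Variable P : probability T R.

Definition sub_sigma_algebra (F : set (set T)) : Prop :=
  sigma_algebra setT F /\ F `<=` measurable.

Definition is_cond_exp (F : set (set T)) (X Y : T -> R) : Prop :=
  [/\ P.-integrable setT (EFin \o X),
      P.-integrable setT (EFin \o Y),
      forall S : set R, measurable S -> F (Y @^-1` S)
    & forall E, F E -> (\int[P]_(w in E) (Y w)%:E = \int[P]_(w in E) (X w)%:E)%E].

(* A chosen version of E[X | F], which is unique up to P-negligible sets;
   meaningful when X is integrable. *)
Definition cond_exp (F : set (set T)) (X : T -> R) : T -> R :=
  xget (fun _ => 0) [set Y | is_cond_exp F X Y].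

Definition cond_exp_mx {m n} (F : set (set T)) (X : T -> 'M[R]_(m, n)) (w : T) :
    'M[R]_(m, n) :=
  \matrix_(i, j) cond_exp F (fun w' => X w' i j) w.

Definition cond_prob (F : set (set T)) (E : set T) : T -> R :=
  cond_exp F (\1_E : T -> R).

(* For measurable E this is q <= P E; it stays meaningful when the measurability
   of E has not been established. *)
Definition with_prob_at_least (q : R) (E : set T) : Prop :=
  exists E' : set T, [/\ measurable E', E' `<=` E & (q%:E <= P E')%E].

End conditioning.

Record lqr (R : realType) (n m : nat) := LQR {
  lqrA : 'M[R]_n;
  lqrB : 'M[R]_(n, m);
  lqrQ : 'M[R]_n;
  lqrR : 'M[R]_m;
  lqrD : probability (borel_mx R n 1) R
}.

Section lqr_problem.
Context {R : realType} {n m : nat}.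
Variable p : lqr R n m.

Let A := lqrA p.
Let B := lqrB p.
Let Q := lqrQ p.
Let Rc := lqrR p.
Let D := lqrD p.

Definition lqr_assumptions (DX : R) : Prop :=
  [/\ sym_posdef Q, sym_posdef Rc, 0 < DX,
      forall i j : 'I_n,
        (\int[D]_x ((x : 'cV[R]_n) i 0 * (x : 'cV[R]_n) j 0)%:E = ((i == j)%:R)%:E)%E
    & {ae D, forall x, frob (x : 'cV[R]_n) <= DX}].

Definition action (K : 'M[R]_(m, n)) (x : 'cV[R]_n) : 'cV[R]_m := - (K *m x).

Fixpoint state (K : 'M[R]_(m, n)) (x : 'cV[R]_n) (i : nat) : 'cV[R]_n :=
  if i is i'.+1 then A *m state K x i' + B *m action K (state K x i') else x.

Definition cost (K : 'M[R]_(m, n)) : \bar R :=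
  (\int[D]_x \sum_(0 <= i <oo)
    (qform Q (state K x i) + qform Rc (action K (state K x i)))%:E)%E.

Definition is_min_cost (fstar : R) : Prop :=
  (exists K, cost K = fstar%:E) /\ (forall K, (fstar%:E <= cost K)%E).

Definition gap (fstar : R) (K : 'M[R]_(m, n)) : \bar R := (cost K - fstar%:E)%E.

Definition stable (K : 'M[R]_(m, n)) : Prop := spectral_radius (A - B *m K) < 1.

Definition grad_cost (K : 'M[R]_(m, n)) : 'M[R]_(m, n) :=
  \matrix_(i, j)
    derive (fun K' : 'M[R]_(m, n) => fine (cost K') : R^o) K (delta_mx i j).

Definition stage_cost (K : 'M[R]_(m, n)) (x : 'cV[R]_n) (i : nat) : R :=
  qform (Q + K^T *m Rc *m K) ((A - B *m K) ^+ i *m x).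

Definition Finf (K : 'M[R]_(m, n)) (x : 'cV[R]_n) : \bar R :=
  (\sum_(0 <= i <oo) (stage_cost K x i)%:E)%E.

Definition Fhor (h : nat) (K : 'M[R]_(m, n)) (x : 'cV[R]_n) : R :=
  \sum_(0 <= i < h) stage_cost K x i.

(* The infinite-horizon estimator is only meaningful when K + alpha U and
   K - alpha U are stable, in which case both values of Finf are finite. *)
Definition Ginf (alpha : R) (K : 'M[R]_(m, n)) (x : 'cV[R]_n) (u : 'M[R]_(m, n)) :
    'M[R]_(m, n) :=
  ((m * n)%:R / (2 * alpha) *
    (fine (Finf (K + alpha *: u) x) - fine (Finf (K - alpha *: u) x))) *: u.

Definition Ghor (h : nat) (alpha : R) (K : 'M[R]_(m, n)) (x : 'cV[R]_n)
    (u : 'M[R]_(m, n)) : 'M[R]_(m, n) :=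
  ((m * n)%:R / (2 * alpha) *
    (Fhor h (K + alpha *: u) x - Fhor h (K - alpha *: u) x)) *: u.

(* The radius r_Delta and the smoothness and gradient-domination constants; the
   last clause says that r_Delta is small, with G_Delta = 2 sqrt (L_Delta Delta). *)
Definition landscape_constants (fstar mu : R) (L r : R -> R) : Prop :=
  0 < mu /\
  forall Dl : R, 0 < Dl ->
  [/\ 0 < L Dl, 0 < r Dl,
      forall K, (gap fstar K < Dl%:E)%E -> forall K', frob (K' - K) <= r Dl ->
        stable K' /\
        (cost K' <= cost K + (mxdot (grad_cost K) (K' - K)
                              + L Dl / 2 * frob (K - K') ^+ 2)%:E)%E,
      forall K, (gap fstar K < Dl%:E)%E ->
        (mu%:E * gap fstar K <= (frob (grad_cost K) ^+ 2)%:E)%E /\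
        ((frob (grad_cost K) ^+ 2)%:E <= (2 * L Dl)%:E * gap fstar K)%E
    & r Dl * (2 * Num.sqrt (L Dl * Dl)) + L Dl * r Dl ^+ 2 / 2 <= Dl].

Section estimator.
Variable s : probability (borel_mx R m n) R.

Definition mean_Ginf (alpha : R) (K : 'M[R]_(m, n)) : 'M[R]_(m, n) :=
  \matrix_(i, j)
    fine (\int[(D \x s)%E]_z (Ginf alpha K z.1 z.2 i j)%:E)%E.

Definition estimator_constants (fstar : R) (L r l : R -> R) : Prop :=
  forall Dl : R, 0 < Dl -> 0 < l Dl /\
  forall (alpha : R) (K : 'M[R]_(m, n)),
    0 < alpha -> alpha <= r Dl -> (gap fstar K <= Dl%:E)%E ->
    [/\ frob (mean_Ginf alpha K - grad_cost K) <= L Dl * alpha,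
        (\int[(D \x s)%E]_z (frob (Ginf alpha K z.1 z.2) ^+ 2)%:E
          <= ((m * n)%:R ^+ 2 * l Dl ^+ 2)%:E)%E
      & {ae (D \x s)%E, forall z,
          frob (Ginf alpha K z.1 z.2) <= (m * n)%:R * l Dl}].

(* T iterations of stochastic policy gradient with the finite-horizon estimator.
   F is any filtration to which the iterates are adapted and of which the samples
   of the current iteration are independent; the sigma-algebras generated by the
   samples of the previous iterations are the typical choice. *)
Record spg_run {d : measure_display} {Omega : measurableType d}
    (P : probability Omega R) (h : nat) (alpha : R) (K0 : 'M[R]_(m, n))
    (eta : nat -> R) (T : nat) (F : nat -> set (set Omega))
    (x : nat -> Omega -> borel_mx R n 1) (U : nat -> Omega -> borel_mx R m n)
    (K : nat -> Omega -> 'M[R]_(m, n)) : Prop := SpgRun {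
  spg_sub_sigma : forall t, (t <= T)%N -> sub_sigma_algebra (F t);
  spg_filtration : forall t, (t < T)%N -> F t `<=` F t.+1;
  spg_adapted : forall t, (t <= T)%N ->
    forall S : set (borel_mx R m n), measurable S -> F t (K t @^-1` S);
  spg_meas_x : forall t, (t < T)%N -> measurable_fun setT (x t);
  spg_meas_U : forall t, (t < T)%N -> measurable_fun setT (U t);
  spg_law_x : forall t, (t < T)%N ->
    forall S : set (borel_mx R n 1), measurable S -> P (x t @^-1` S) = D S;
  spg_law_U : forall t, (t < T)%N ->
    forall S : set (borel_mx R m n), measurable S -> P (U t @^-1` S) = s S;
  spg_indep : forall t, (t < T)%N ->
    forall (Sx : set (borel_mx R n 1)) (SU : set (borel_mx R m n)) (E : set Omega),
      measurable Sx -> measurable SU -> F t E ->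
      P (x t @^-1` Sx `&` U t @^-1` SU `&` E)
        = (P (x t @^-1` Sx) * P (U t @^-1` SU) * P E)%E;
  spg_init : forall w, K 0%N w = K0;
  spg_step : forall t, (t < T)%N -> forall w,
    K t.+1 w = K t w - eta t *: Ghor h alpha (K t w) (x t w) (U t w)
}.

End estimator.
End lqr_problem.

(* Main.v *)
Require Import Defs.
From HB Require Import structures.
From mathcomp Require Import all_boot all_order all_algebra.
From mathcomp Require Import all_classical all_reals all_analysis.
From mathcomp Require Import measurable_realfun.
From mathcomp Require Import ring lra.
Import Order.TTheory GRing.Theory Num.Theory.
Import numFieldNormedType.Exports.
Local Open Scope classical_set_scope.
Local Open Scope ring_scope.

(* Write [P_K] for the sum of the matrices [(A-BK)^i^T (Q + K^T R K) (A-BK)^i].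
   Since the initial state has identity covariance, [f(K) = tr P_K], hence
   [F(K;x) = x^T P_K x <= f(K) |x|^2], while one step lowers [F] by at least
   [lambda_min(Q) |x|^2]; so [F(K;.)] contracts by [1 - lambda_min(Q) / f(K)] along
   the closed loop. This bounds the truncation error of the estimator by
   [epsh <= d l], with [f(K + alpha U), f(K - alpha U) <= f_(2 Delta)], and
   everything about [G_h] follows from the assumptions on the infinite-horizon
   estimator. In particular [|G_h| <= M] almost surely.

   For the convergence, put [q = N + t] and let [Delta_t] be the optimality gap of
   [K_t]. The exponential moment
   [exp (theta ((q - 1) (Delta_t - eps / 2) - C0))], with
   [theta = mu / (16 (M + G)^2)], is almost a supermartingale: smoothness gives
   [q Delta_(t+1) <= q Delta_t - (2 / mu) <grad f, G_t> + a / q], the conditional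
   mean of the inner product is at least [|grad f|^2 - mu eps / 8], and the second
   order term of the exponential is absorbed by [|grad f|^2 >= mu Delta_t]. Whenever the remaining drift
   [- Delta_t / 2] does not absorb [a / q], the exponent is nonpositive. So the
   expectation grows by at most [1] per step, and Markov's inequality at the first
   exit from [Delta_t <= eps / 2 + (C0 + u) / (q - 1)], with [u = log (1 / delta) / theta],
   bounds the failure probability by [(T + 1) delta <= 2 T delta]. *)

(** * Independence and freezing *)

Section independent_product.
Context {R : realType} {d d1 d2 : measure_display} {T : measurableType d}
  {T1 : measurableType d1} {T2 : measurableType d2}.
Variables (P : probability T R) (m1 : probability T1 R) (m2 : probability T2 R).
Variables (X : T -> T1) (Y : T -> T2).
Hypotheses (mX : measurable_fun setT X) (mY : measurable_fun setT Y).

(** The law of [(X, Y)] under [P] restricted to [E] and the product measure scaled by [P E] agree on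
    rectangles, hence everywhere by uniqueness of product measures. *)
Lemma independent_pair_law (E : set T) : measurable E ->
  (forall A B, measurable A -> measurable B ->
     P (E `&` (X @^-1` A `&` Y @^-1` B)) = (P E * (m1 A * m2 B))%E) ->
  forall S, measurable S ->
    P (E `&` (fun w => (X w, Y w)) @^-1` S) = (P E * (m1 \x m2)%E S)%E.
Proof.
move=> mE indep S mS.
have mXY : measurable_fun setT (fun w => (X w, Y w)) by exact: measurable_fun_pair.
have PE0 : 0 <= fine (P E) by rewrite fine_ge0.
(* The factor [P E] is absorbed into the first marginal, so that the right-hand side is again a
   product of two measures. *)
pose c : {nonneg R} := NngNum PE0.
have cE : c%:num%:E = P E by rewrite /= fineK// fin_num_measure.
pose nu : {measure set (T1 * T2) -> \bar R} := pushforward (mrestr P mE) (fun w => (X w, Y w)).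
transitivity (nu mXY S); first by rewrite /nu/= /pushforward /mrestr setIC.
rewrite -(@product_measure_unique _ _ _ _ _ (mscale c m1) m2)//; last first.
  move=> A B mA mB; rewrite /nu/= /pushforward /mrestr /mscale/=.
  by rewrite -muleA cE -indep// setIC; congr (P (_ `&` _)).
rewrite /product_measure1 /= ge0_integral_mscale//; first by rewrite cE.
exact: measurable_fun_xsection.
Qed.

End independent_product.

Section freezing.
Context {R : realType} {d dZ : measure_display} {T : measurableType d}
  {Z : measurableType dZ}.
Variables (P : probability T R) (mu : probability Z R) (F : set (set T)).
Variable z : T -> Z.
Hypotheses (sF : Defs.sub_sigma_algebra F) (mz : measurable_fun setT z).
Hypothesis indep : forall E S, F E -> measurable S ->
  P (E `&` z @^-1` S) = (P E * mu S)%E.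

(** [T] carrying [F] as its sigma-algebra: [F]-measurability becomes ordinary measurability, so that
    product measures and Fubini apply to it. *)
Local Notation TF := (g_sigma_algebraType F).

Lemma measurable_sub_sigma (E : set T) :
  measurable (E : set TF) <-> F E.
Proof. by rewrite measurable_g_measurableTypeE//; case: sF. Qed.

Lemma measurable_fun_sub_sigmaP {d' : measure_display} {T' : measurableType d'}
    (f : T -> T') :
  measurable_fun setT (f : TF -> T') <-> forall S, measurable S -> F (f @^-1` S).
Proof.
split=> [mf S mS|mf _ S mS].
  by apply/measurable_sub_sigma; rewrite -[X in measurable X]setTI; exact: mf.
by rewrite setTI; apply/measurable_sub_sigma; exact: mf.
Qed.

Let mid : measurable_fun setT (idfun : T -> TF).
Proof.
move=> _ E /measurable_sub_sigma FE; rewrite setTI.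
by case: sF => _; apply.
Qed.

Lemma sub_sigma_measurable_fun {d' : measure_display} {T' : measurableType d'}
    (f : T -> T') :
  measurable_fun setT (f : TF -> T') -> measurable_fun setT f.
Proof. by move=> mf; exact: (measurableT_comp mf mid). Qed.

Let jmap (w : T) : TF * Z := (w, z w).

Let mjmap : measurable_fun setT jmap.
Proof. by apply: measurable_fun_pair => //; exact: mid. Qed.

Let PF : probability TF R := distribution P (mfun_Sub (mem_set mid)).
Let PJ : probability (TF * Z)%type R := distribution P (mfun_Sub (mem_set mjmap)).

(** Independence identifies the joint law of [(w, z w)] with the product on rectangles. The freezing
    statements below are Tonelli and Fubini for this product. *)
Let law S : measurable S -> PJ S = (PF \x mu)%E S.
Proof.
move=> mS; rewrite -(@product_measure_unique _ _ _ _ _ PF mu PJ)// => A B mA mB.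
by apply: indep => //; exact/measurable_sub_sigma.
Qed.

Lemma ge0_integral_freezing (g : TF * Z -> \bar R) :
  measurable_fun setT g -> (forall v, 0 <= g v)%E ->
  (\int[P]_w g (w, z w) = \int[P]_w \int[mu]_v g (w, v))%E.
Proof.
move=> mg g0.
transitivity (\int[PJ]_v g v)%E.
  by rewrite (@ge0_integral_pushforward _ _ _ _ _ _ mjmap P setT).
rewrite (eq_measure_integral (PF \x mu)%E); last by move=> A mA _; exact: law.
rewrite fubini_tonelli1//.
rewrite [LHS](@ge0_integral_pushforward _ _ _ _ _ _ mid P setT)//.
  exact: measurable_fun_fubini_tonelli_F.
by move=> w _; exact: integral_ge0.
Qed.

Lemma measurable_ge0_integral_freezing (g : TF * Z -> \bar R) :
  measurable_fun setT g -> (forall v, 0 <= g v)%E ->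
  measurable_fun setT (fun w : T => \int[mu]_v g (w, v))%E.
Proof.
move=> mg g0; apply: sub_sigma_measurable_fun.
rewrite -[X in measurable_fun _ X]/(fubini_F mu g).
exact: measurable_fun_fubini_tonelli_F.
Qed.

Lemma integrable_freezing (g : TF * Z -> \bar R) :
  measurable_fun setT g -> P.-integrable setT (fun w => g (w, z w)) ->
  (PF \x mu)%E.-integrable setT g.
Proof.
move=> mg ig.
have : PJ.-integrable setT g.
  exact: (@integrable_pushforward _ _ _ _ _ _ mjmap P setT).
move=> /integrableP[_ goo]; apply/integrableP; split => //.
rewrite (eq_measure_integral PJ)// => A mA _.
by rewrite [RHS]law.
Qed.

Let integral_PF (E : set T) (f : TF -> \bar R) : F E ->
  measurable_fun setT f -> P.-integrable setT f ->
  (\int[PF]_(w in (E : set TF)) f w = \int[P]_(w in E) f w)%E.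
Proof.
move=> FE mf iF; rewrite [LHS](@integral_pushforward _ _ _ _ _ _ mid P)//.
  by apply: integrableS iF => //; case: sF => _; apply.
exact/measurable_sub_sigma.
Qed.

Lemma is_cond_exp_freezing (g : TF * Z -> R) :
  measurable_fun setT g -> P.-integrable setT (fun w => (g (w, z w))%:E) ->
  is_cond_exp P F (fun w => g (w, z w)) (fun w => fine (\int[mu]_v (g (w, v))%:E)%E).
Proof.
move=> mg ig.
have mEg : measurable_fun setT (EFin \o g) by exact/measurable_EFinP.
have igP := integrable_freezing _ mEg ig.
pose Y w : R := fine (\int[mu]_v (g (w, v))%:E)%E.
have mY : measurable_fun setT (Y : TF -> R).
  apply: measurableT_comp => //; exact: (measurable_fubini_F igP).
(* [fine] sends infinite values to 0; by Fubini the inner integral is finite outside a null set. *)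
have aeY : {ae PF, forall w, (Y w)%:E = (\int[mu]_v (g (w, v))%:E)%E}.
  apply: filterS (ae_integrable1 igP) => w iw.
  by rewrite /Y fineK// integrable_fin_num.
have mEY : measurable_fun setT (EFin \o Y : TF -> \bar R) by exact/measurable_EFinP.
have iYF : PF.-integrable setT (EFin \o Y).
  apply/integrableP; split => //.
  have /integrableP[_] := integrable_fubini_F igP; apply: le_lt_trans.
  rewrite (ae_eq_integral (fun w => `|fubini_F mu (EFin \o g) w|)%E)//.
  - exact: measurableT_comp.
  - by apply: measurableT_comp => //; exact: (measurable_fubini_F igP).
  - by apply: filterS aeY => w Yw _; congr abse; exact: Yw.
have iY : P.-integrable setT (EFin \o Y).
  apply/integrableP; split; first exact: sub_sigma_measurable_fun.
  have /integrableP[_] := iYF; apply: le_lt_trans.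
  rewrite [leRHS](@ge0_integral_pushforward _ _ _ _ _ _ mid P setT)//.
  exact: measurableT_comp.
split => //.
  by apply/measurable_fun_sub_sigmaP.
move=> E FE.
have mE : measurable (E : set TF) by exact/measurable_sub_sigma.
pose g' (v : TF * Z) : R := \1_E v.1 * g v.
have mg' : measurable_fun setT g'.
  by apply: measurable_funM => //; apply: measurableT_comp => //; exact: measurable_indic.
have ig' : P.-integrable setT (fun w => (g' (w, z w))%:E).
  apply: le_integrable ig => //.
    by apply/measurable_EFinP; apply: (@measurableT_comp _ _ _ _ _ _ g' _ jmap).
  move=> w _ /=; rewrite lee_fin normrM ler_piMl//.
  by rewrite indicE; case: (_ \in _); rewrite ?normr1 ?normr0.
have mEg' : measurable_fun setT (EFin \o g') by exact/measurable_EFinP.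
have ig'P := integrable_freezing _ mEg' ig'.
rewrite -integral_PF//.
rewrite (ae_eq_integral (fubini_F mu (EFin \o g)))//; first last.
- by apply: filterS aeY => w Yw _; exact: Yw.
- by apply: measurable_funTS; exact: (measurable_fubini_F igP).
- exact: measurable_funTS.
rewrite integral_mkcond (eq_integral (fubini_F mu (EFin \o g'))); last first.
  move=> w _; rewrite /fubini_F patchE /g'/= indicE; case: (w \in E).
    by apply: eq_integral => v _; rewrite mul1r.
  by under [RHS]eq_integral do rewrite mul0r; rewrite integral0.
rewrite integral12_prod_meas1// (eq_measure_integral PJ); last first.
  by move=> A mA _; exact/esym/law.
rewrite (@integral_pushforward _ _ _ _ _ _ mjmap P setT)// preimage_setT.
rewrite [RHS]integral_mkcond; apply: eq_integral => w _.
by rewrite patchE /g'/= indicE; case: (w \in E); rewrite ?mul1r ?mul0r.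
Qed.

(** On [TF], two versions have equal integrals over all measurable sets, so they differ on a null
    set only. The existence of [Y] ensures that [xget] selects a genuine version. *)
Lemma cond_exp_unique (X Y : T -> R) : is_cond_exp P F X Y ->
  {ae P, forall w, cond_exp P F X w = Y w}.
Proof.
move=> XY; have : is_cond_exp P F X (cond_exp P F X).
  by rewrite /cond_exp; apply: (@xgetPex _ _ [set Y | is_cond_exp P F X Y]); exists Y.
case: XY => _ iY mY eY [_ iC mC eC].
have toTF (f : T -> R) : (forall S, measurable S -> F (f @^-1` S)) ->
    measurable_fun setT (EFin \o f : TF -> \bar R).
  by move=> mf; apply/measurable_EFinP/measurable_fun_sub_sigmaP.
have : ae_eq PF setT (EFin \o cond_exp P F X) (EFin \o Y).
  apply: integral_ae_eq => //.
  - exact: (@integrable_pushforward _ _ _ _ _ _ mid P setT _ (toTF _ mC)).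
  - exact: toTF.
  - move=> E _ /measurable_sub_sigma FE.
    rewrite (integral_PF _ _ FE (toTF _ mC) iC) (integral_PF _ _ FE (toTF _ mY) iY).
    by rewrite eC// eY.
move=> [N [mN PN0 sN]]; exists N; split => //.
  by move/measurable_sub_sigma : mN; case: sF => _; apply.
by move=> w /= wN; apply: sN => /= /(_ I) [].
Qed.

Lemma cond_exp_freezing (g : TF * Z -> R) :
  measurable_fun setT g -> P.-integrable setT (fun w => (g (w, z w))%:E) ->
  {ae P, forall w, cond_exp P F (fun w => g (w, z w)) w =
                   fine (\int[mu]_v (g (w, v))%:E)%E}.
Proof. by move=> mg ig; apply/cond_exp_unique/is_cond_exp_freezing. Qed.

End freezing.

(** * Frobenius geometry and quadratic forms *)

Section frobenius.
Context {R : realType} {m n : nat}.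
Implicit Types X Y Z : 'M[R]_(m, n).

Lemma mxdotC X Y : mxdot X Y = mxdot Y X.
Proof. by apply: eq_bigr => i _; apply: eq_bigr => j _; rewrite mulrC. Qed.

Lemma mxdotDr X Y Z : mxdot X (Y + Z) = mxdot X Y + mxdot X Z.
Proof.
rewrite /mxdot -big_split; apply: eq_bigr => i _; rewrite -big_split.
by apply: eq_bigr => j _; rewrite mxE mulrDr.
Qed.

Lemma mxdotZr a X Y : mxdot X (a *: Y) = a * mxdot X Y.
Proof.
rewrite /mxdot big_distrr; apply: eq_bigr => i _; rewrite big_distrr.
by apply: eq_bigr => j _; rewrite mxE mulrCA.
Qed.

Lemma mxdotNr X Y : mxdot X (- Y) = - mxdot X Y.
Proof. by rewrite -scaleN1r mxdotZr mulN1r. Qed.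

Lemma mxdotBr X Y Z : mxdot X (Y - Z) = mxdot X Y - mxdot X Z.
Proof. by rewrite mxdotDr mxdotNr. Qed.

Lemma mxdot_ge0 X : 0 <= mxdot X X.
Proof. by do 2 (apply: sumr_ge0 => ? _); rewrite -expr2 sqr_ge0. Qed.

Lemma frob_ge0 X : 0 <= frob X. Proof. exact: sqrtr_ge0. Qed.

Lemma sqr_frob X : frob X ^+ 2 = mxdot X X.
Proof. by rewrite sqr_sqrtr// mxdot_ge0. Qed.

Lemma frobN X : frob (- X) = frob X.
Proof. by rewrite /frob mxdotNr mxdotC mxdotNr opprK. Qed.

Lemma frobZ a X : frob (a *: X) = `|a| * frob X.
Proof.
by rewrite /frob mxdotZr mxdotC mxdotZr mulrA -expr2 sqrtrM ?sqr_ge0// sqrtr_sqr.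
Qed.

Lemma frob_distC X Y : frob (X - Y) = frob (Y - X).
Proof. by rewrite -frobN opprB. Qed.

Lemma frob0 : frob (0 : 'M[R]_(m, n)) = 0.
Proof. by rewrite -(scale0r 0) frobZ normr0 mul0r. Qed.

Lemma sqr_coord_le_frob X i j : X i j ^+ 2 <= frob X ^+ 2.
Proof.
rewrite sqr_frob /mxdot (bigD1 i)//= (bigD1 j)//= -expr2 -addrA lerDl.
rewrite addr_ge0// ?sumr_ge0// => k _; first by rewrite -expr2 sqr_ge0.
by apply: sumr_ge0 => l _; rewrite -expr2 sqr_ge0.
Qed.

Lemma coord_le_frob X i j : `|X i j| <= frob X.
Proof.
rewrite -(ler_pXn2r (n := 2))// ?nnegrE ?frob_ge0//.
by rewrite real_normK ?num_real// sqr_coord_le_frob.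
Qed.

Lemma frob_eq0 X : frob X = 0 -> X = 0.
Proof.
move=> X0; apply/matrixP => i j; rewrite mxE; apply/eqP.
by rewrite -normr_le0 -X0 coord_le_frob.
Qed.

Lemma mxdot_le_frob X Y : mxdot X Y <= frob X * frob Y.
Proof.
have [X0|X0] := eqVneq (frob X) 0.
  by rewrite X0 (frob_eq0 _ X0) mul0r -(scale0r 0) mxdotC mxdotZr mul0r.
have Xp : 0 < frob X by rewrite lt0r X0 frob_ge0.
(* Cauchy-Schwarz: the part of [Y] orthogonal to [X] has nonnegative squared norm. *)
have := mxdot_ge0 (Y - (mxdot X Y / frob X ^+ 2) *: X).
set c := _ / _.
rewrite mxdotBr mxdotZr [X in X - _]mxdotC [X in _ - _ * X]mxdotC.
rewrite !mxdotBr !mxdotZr -!sqr_frob (mxdotC Y X) => h.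
have cE : c * frob X ^+ 2 = mxdot X Y by rewrite /c mulfVK// expf_neq0.
rewrite cE subrr mulr0 subr0 in h.
have : mxdot X Y ^+ 2 <= (frob X * frob Y) ^+ 2.
  rewrite exprMn -subr_ge0.
  have -> : frob X ^+ 2 * frob Y ^+ 2 - mxdot X Y ^+ 2 =
     frob X ^+ 2 * (frob Y ^+ 2 - c * mxdot X Y).
    by rewrite -cE; ring.
  by rewrite mulr_ge0// sqr_ge0.
rewrite -[leLHS]real_normK ?num_real// ler_pXn2r ?nnegrE ?mulr_ge0 ?frob_ge0//.
by apply: le_trans; exact: ler_norm.
Qed.

Lemma norm_mxdot_le X Y : `|mxdot X Y| <= frob X * frob Y.
Proof.
by rewrite ler_norml mxdot_le_frob lerNl -mxdotNr -(frobN Y) mxdot_le_frob.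
Qed.

Lemma frobD X Y : frob (X + Y) <= frob X + frob Y.
Proof.
rewrite -(ler_pXn2r (n := 2))// ?nnegrE ?addr_ge0 ?frob_ge0//.
rewrite sqr_frob mxdotDr mxdotC mxdotDr [X in _ + X]mxdotC mxdotDr.
rewrite -!sqr_frob (mxdotC Y X) sqrrD mulr2n.
by rewrite !addrA lerD2r -!addrA lerD2l lerD// mxdot_le_frob.
Qed.

End frobenius.

Section quadratic_form.
Context {R : realType} {n : nat}.
Implicit Types (M S : 'M[R]_n) (x : 'cV[R]_n).

Lemma qformE M x : qform M x = \sum_i \sum_j M i j * (x i 0 * x j 0).
Proof.
rewrite /qform !mxE exchange_big/=; apply: eq_bigr => j _.
rewrite mxE big_distrl/=; apply: eq_bigr => i _.
by rewrite !mxE; ring.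
Qed.

Lemma qformD M S x : qform (M + S) x = qform M x + qform S x.
Proof. by rewrite /qform mulmxDr mulmxDl mxE. Qed.

Lemma qform0 x : qform 0 x = 0.
Proof. by rewrite /qform mulmx0 mul0mx mxE. Qed.

Lemma qform_sum (I : Type) (r : seq I) (F : I -> 'M[R]_n) x :
  qform (\sum_(i <- r) F i) x = \sum_(i <- r) qform (F i) x.
Proof. by elim/big_rec2: _ => [|i y M _ <-]; rewrite ?qform0 ?qformD. Qed.

Lemma qform_congr k (B : 'M[R]_(n, k)) M (y : 'cV[R]_k) :
  qform (B^T *m M *m B) y = qform M (B *m y).
Proof. by rewrite /qform trmx_mul !mulmxA. Qed.

Lemma qform_scalar a x : qform a%:M x = a * frob x ^+ 2.
Proof.
rewrite qformE sqr_frob /mxdot big_distrr/=; apply: eq_bigr => i _.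
rewrite (bigD1 i)//= big1 => [|j ji]; last by rewrite mxE eq_sym (negbTE ji) mul0r.
by rewrite mxE eqxx addr0 big_ord1.
Qed.

(* Nonnegativity on [x_j e_i - x_i e_j] gives
   [x_i x_j (S_ij + S_ji) <= x_i^2 S_jj + x_j^2 S_ii]; sum over i and j. *)
Lemma qform_le_trace S x : (forall y, 0 <= qform S y) ->
  qform S x <= \tr S * frob x ^+ 2.
Proof.
move=> S0.
have pair i j : (x i 0 * x j 0) * (S i j + S j i) <=
    x i 0 ^+ 2 * S j j + x j 0 ^+ 2 * S i i.
  have := S0 (x j 0 *: delta_mx i 0 - x i 0 *: delta_mx j 0).
  have dE (B : 'M[R]_n) a b : ((delta_mx 0 a : 'rV_n) *m B *m (delta_mx b 0 : 'cV_n)) 0 0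
      = B a b.
    by rewrite -rowE -colE !mxE.
  have -> : qform S (x j 0 *: delta_mx i 0 - x i 0 *: delta_mx j 0) =
     x j 0 ^+ 2 * S i i - x j 0 * x i 0 * S i j - x i 0 * x j 0 * S j i
     + x i 0 ^+ 2 * S j j.
    have -> y : qform S y = (y^T *m S *m y) 0 0 by [].
    have -> : (x j 0 *: delta_mx i 0 - x i 0 *: delta_mx j 0 : 'cV[R]_n)^T =
       x j 0 *: delta_mx 0 i - x i 0 *: delta_mx 0 j.
      by apply/matrixP => k l; rewrite !mxE (andbC (l == i)) (andbC (l == j)).
    rewrite !mulmxBl !mulmxBr -!scalemxAl -!scalemxAr.
    have mxB0 (B C : 'M[R]_1) : (B - C) 0 0 = B 0 0 - C 0 0 by rewrite !mxE.
    have mxZ0 c (C : 'M[R]_1) : (c *: C) 0 0 = c * C 0 0 by rewrite !mxE.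
    by rewrite !(mxB0, mxZ0) !dE; ring.
  move=> h; rewrite -subr_ge0; apply: le_trans h _.
  by rewrite le_eqVlt; apply/orP; left; apply/eqP; ring.
have : \sum_i \sum_j (x i 0 * x j 0) * (S i j + S j i) <=
    \sum_i \sum_j (x i 0 ^+ 2 * S j j + x j 0 ^+ 2 * S i i).
  by do 2 (apply: ler_sum => ? _).
have -> : \sum_i \sum_j (x i 0 * x j 0) * (S i j + S j i) = 2 * qform S x.
  rewrite mulr_natl mulr2n qformE [X in _ = _ + X]exchange_big/= -big_split/=.
  apply: eq_bigr => i _; rewrite -big_split/=; apply: eq_bigr => j _; ring.
suff -> : \sum_i \sum_j (x i 0 ^+ 2 * S j j + x j 0 ^+ 2 * S i i) =
    2 * (\tr S * frob x ^+ 2) by rewrite ler_pM2l.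
have fE : frob x ^+ 2 = \sum_i x i 0 ^+ 2.
  by rewrite sqr_frob; apply: eq_bigr => i _; rewrite big_ord1 expr2.
have tE : \sum_i \sum_j x i 0 ^+ 2 * S j j = \tr S * frob x ^+ 2.
  rewrite fE mulrC big_distrl/=; apply: eq_bigr => i _.
  by rewrite /mxtrace big_distrr.
rewrite [RHS]mulr_natl mulr2n -{1}tE -tE [X in _ = _ + X]exchange_big/= -big_split/=.
by apply: eq_bigr => i _; rewrite -big_split.
Qed.

End quadratic_form.

(** Stage costs and the finite-horizon estimator are polynomial in the entries of policy, state and
    direction. Continuity, measurability and almost sure boundedness are all closed under ring
    operations, so one closure proof serves the three properties. *)
Record function_subring {R : realType} {T : Type} (S : (T -> R) -> Prop) : Prop := {
  fsubring_cst : forall c, S (fun=> c);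
  fsubring_add : forall f g, S f -> S g -> S (fun t => f t + g t);
  fsubring_mul : forall f g, S f -> S g -> S (fun t => f t * g t) }.

Definition mx_entries {R : realType} {T : Type} (S : (T -> R) -> Prop) {m n}
    (f : T -> 'M[R]_(m, n)) : Prop :=
  forall i j, S (fun t => f t i j).

Section matrix_valued.
Context {R : realType} {T : Type} {S : (T -> R) -> Prop} (subS : function_subring S).

Lemma fsubring_ext (f g : T -> R) : f =1 g -> S f -> S g.
Proof. by move=> /funext ->. Qed.

Lemma fsubring_sum (I : Type) (r : seq I) (F : I -> T -> R) :
  (forall i, S (F i)) -> S (fun t => \sum_(i <- r) F i t).
Proof.
move=> SF; elim: r => [|i r IH].
  by apply: fsubring_ext (fsubring_cst _ subS 0) => t; rewrite big_nil.
apply: fsubring_ext (fsubring_add _ subS _ _ (SF i) IH) => t.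
by rewrite big_cons.
Qed.

Lemma mx_entries_cst {m n} (M : 'M[R]_(m, n)) : mx_entries S (fun=> M).
Proof. by move=> i j; exact: fsubring_cst. Qed.

Lemma mx_entriesD {m n} (f g : T -> 'M[R]_(m, n)) :
  mx_entries S f -> mx_entries S g -> mx_entries S (fun t => f t + g t).
Proof.
move=> Sf Sg i j; apply: fsubring_ext (fsubring_add _ subS _ _ (Sf i j) (Sg i j)) => t.
by rewrite mxE.
Qed.

Lemma mx_entriesZ {m n} (a : T -> R) (f : T -> 'M[R]_(m, n)) :
  S a -> mx_entries S f -> mx_entries S (fun t => a t *: f t).
Proof.
move=> Sa Sf i j; apply: fsubring_ext (fsubring_mul _ subS _ _ Sa (Sf i j)) => t.
by rewrite mxE.
Qed.

Lemma mx_entriesN {m n} (f : T -> 'M[R]_(m, n)) :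
  mx_entries S f -> mx_entries S (fun t => - f t).
Proof.
move=> Sf i j.
apply: fsubring_ext (mx_entriesZ (fun=> -1) f (fsubring_cst _ subS _) Sf i j) => t.
by rewrite scaleN1r.
Qed.

Lemma mx_entriesB {m n} (f g : T -> 'M[R]_(m, n)) :
  mx_entries S f -> mx_entries S g -> mx_entries S (fun t => f t - g t).
Proof. by move=> Sf Sg; apply: mx_entriesD => //; exact: mx_entriesN. Qed.

Lemma mx_entries_tr {m n} (f : T -> 'M[R]_(m, n)) :
  mx_entries S f -> mx_entries S (fun t => (f t)^T).
Proof. by move=> Sf i j; apply: fsubring_ext (Sf j i) => t; rewrite mxE. Qed.

Lemma mx_entriesM {m n k} (f : T -> 'M[R]_(m, n)) (g : T -> 'M[R]_(n, k)) :
  mx_entries S f -> mx_entries S g -> mx_entries S (fun t => f t *m g t).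
Proof.
move=> Sf Sg i j.
apply: (@fsubring_ext (fun t => \sum_l f t i l * g t l j)) => [t|].
  by rewrite mxE.
by apply: fsubring_sum => l; exact: fsubring_mul.
Qed.

Lemma mx_entriesX {n} (f : T -> 'M[R]_n) k :
  mx_entries S f -> mx_entries S (fun t => f t ^+ k).
Proof.
move=> Sf; elim: k => [|k IH].
  by move=> i j; apply: fsubring_ext (mx_entries_cst 1 i j).
by move=> i j; apply: fsubring_ext (mx_entriesM _ _ Sf IH i j) => t; rewrite exprS.
Qed.

Lemma fsubring_trace {n} (f : T -> 'M[R]_n) :
  mx_entries S f -> S (fun t => \tr (f t)).
Proof. by move=> Sf; apply: fsubring_sum => i; exact: Sf. Qed.

Lemma fsubring_qform {n} (M : T -> 'M[R]_n) (x : T -> 'cV[R]_n) :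
  mx_entries S M -> mx_entries S x -> S (fun t => qform (M t) (x t)).
Proof.
move=> SM Sx; apply: (mx_entriesM _ _ _ Sx).
by apply: mx_entriesM => //; exact: mx_entries_tr.
Qed.

Lemma fsubring_mxdot {m n} (f g : T -> 'M[R]_(m, n)) :
  mx_entries S f -> mx_entries S g -> S (fun t => mxdot (f t) (g t)).
Proof.
move=> Sf Sg; apply: fsubring_sum => i; apply: fsubring_sum => j.
exact: fsubring_mul.
Qed.

End matrix_valued.

Lemma function_subring_continuous {R : realType} (T : topologicalType) :
  function_subring (fun f : T -> R => continuous f).
Proof.
split=> [c|f g cf cg|f g cf cg]; first exact: cst_continuous.
- by move=> t; apply: (@continuousD _ R^o); [exact: cf|exact: cg].
- by move=> t; apply: continuousM; [exact: cf|exact: cg].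
Qed.

Lemma function_subring_measurable {R : realType} {d} (T : measurableType d) :
  function_subring (fun f : T -> R => measurable_fun setT f).
Proof.
split=> [c|f g mf mg|f g mf mg]; first exact: measurable_cst.
- exact: measurable_funD.
- exact: measurable_funM.
Qed.

Section psd_kernel.
Context {R : realType} {n : nat}.

Lemma mxdot_cVE (x y : 'cV[R]_n) : mxdot x y = (x^T *m y) 0 0.
Proof. by rewrite mxE; apply: eq_bigr => i _; rewrite big_ord1 mxE. Qed.

Lemma qform_mxdot (M : 'M[R]_n) x : qform M x = mxdot x (M *m x).
Proof. by rewrite mxdot_cVE mulmxA. Qed.

Lemma mxdot_mulmx_trmx (M : 'M[R]_n) (x y : 'cV[R]_n) :
  mxdot x (M *m y) = mxdot (M^T *m x) y.
Proof. by rewrite !mxdot_cVE trmx_mul trmxK mulmxA. Qed.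

(** With [b = |S x|^2] and [q] the value of the form at [S x], the form at [x + t S x] is
    [2 t b + t^2 q]. For small negative [t] the linear term dominates, so nonnegativity forces
    [b = 0]. *)
Lemma psd_null_vector (S : 'M[R]_n) x :
  S^T = S -> (forall y, 0 <= qform S y) -> qform S x = 0 -> S *m x = 0.
Proof.
move=> symS S0 x0; pose y := S *m x; apply/frob_eq0/eqP.
rewrite -sqrf_eq0 eq_le sqr_ge0 andbT -/y.
set b := frob y ^+ 2; have b0 : 0 <= b by exact: sqr_ge0.
have q0 := S0 y; set q := qform S y in q0.
have q1 : 0 < q + 1 by rewrite ltr_wpDl.
have qt t : qform S (x + t *: y) = 2 * t * b + t ^+ 2 * q.
  rewrite qform_mxdot mulmxDr -scalemxAr mxdotC mxdotDr mxdotZr.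
  rewrite [mxdot _ x]mxdotC [mxdot _ y]mxdotC !mxdotDr !mxdotZr -!qform_mxdot x0.
  have xy : mxdot x (S *m y) = b by rewrite mxdot_mulmx_trmx symS -/y /b sqr_frob.
  by rewrite xy -/y -sqr_frob -/b -/q; ring.
(* Dividing by [q + 1] instead of [q] covers the case [q = 0]. *)
have := S0 (x + (- (b / (q + 1))) *: y); rewrite qt.
have -> : 2 * - (b / (q + 1)) * b + (- (b / (q + 1))) ^+ 2 * q =
  - (b ^+ 2 * (q + 2) / (q + 1) ^+ 2) by field; rewrite gt_eqF.
rewrite oppr_ge0 pmulr_lle0 ?invr_gt0 ?exprn_gt0//.
rewrite pmulr_lle0; last by rewrite ltr_wpDl.
move=> bb; have : b ^+ 2 == 0 by rewrite eq_le bb sqr_ge0.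
by rewrite sqrf_eq0 => /eqP ->.
Qed.

End psd_kernel.

(* A minimiser [x] of [qform Q] on the unit sphere, with value [c], is a null
   vector of the positive semidefinite form [qform (Q - c)], hence in the kernel
   of [Q - c]. *)
Lemma lambda_min_posdef {R : realType} {n} (Q : 'M[R]_n) : (0 < n)%N -> sym_posdef Q ->
  0 < lambda_min Q /\ forall x, lambda_min Q * frob x ^+ 2 <= qform Q x.
Proof.
move=> n0 [symQ posQ].
pose A := [set v : 'rV[R]_n | frob v^T ^+ 2 = 1].
have cidr : mx_entries (fun f : 'rV[R]_n -> R => continuous f) id.
  by move=> i j; exact: coord_continuous.
have subC := function_subring_continuous (R := R) 'rV[R]_n.
have cq M : continuous (fun v : 'rV[R]_n => qform M v^T).
  by apply: (fsubring_qform subC); [exact: mx_entries_cst|exact: mx_entries_tr].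
have cA : compact A.
  apply: bounded_closed_compact.
    exists 1; split => // t t1 v Av; apply: ltW; apply: le_lt_trans t1.
    rewrite -[`|v|]/(mx_norm v) mx_normrE; apply: bigmax_le => // -[i j] _ /=.
    have := coord_le_frob v^T j i; rewrite mxE => /le_trans; apply.
    have /eqP := Av; rewrite sqrf_eq1 => /orP[/eqP -> //|/eqP vN].
    by rewrite vN; lra.
  rewrite (_ : A = (fun v : 'rV[R]_n => mxdot v^T v^T) @^-1` [set 1]); last first.
    by apply/seteqP; split => v; rewrite /A/= sqr_frob.
  apply: closed_comp; last exact: closed_eq.
  move=> v _.
  by apply: (fsubring_mxdot subC); exact: mx_entries_tr.
have A0 : A !=set0.
  exists (delta_mx 0 (Ordinal n0)); rewrite /A/= sqr_frob trmx_delta /mxdot.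
  rewrite (bigD1 (Ordinal n0))//= big_ord1 !mxE !eqxx mulr1 big1 ?addr0// => i ni.
  by rewrite big_ord1 !mxE (negbTE ni) mul0r.
have [v0] := compact_EVT_min A0 cA (continuous_subspaceT (cq Q)).
rewrite inE => Av0 minv0.
set x0 := v0^T; pose c := qform Q x0.
have x01 : frob x0 ^+ 2 = 1 by [].
have minc x : c * frob x ^+ 2 <= qform Q x.
  have [x0'|xN0] := eqVneq (frob x) 0.
    by rewrite (frob_eq0 _ x0') frob0 expr0n mulr0 /qform mulmx0 mxE.
  have xp : 0 < frob x by rewrite lt0r xN0 frob_ge0.
  have qZ a y : qform Q (a *: y) = a ^+ 2 * qform Q y.
    rewrite !qformE big_distrr/=; apply: eq_bigr => i _; rewrite big_distrr/=.
    by apply: eq_bigr => j _; rewrite !mxE; ring.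
  have := minv0 ((frob x)^-1 *: x)^T; rewrite inE/= /A/= !trmxK -/x0 -/c qZ.
  rewrite frobZ exprMn real_normK ?num_real// exprVn mulVf ?expf_neq0//.
  by move=> /(_ erefl); rewrite ler_pdivlMl ?exprn_gt0// mulrC.
have kerx0 : (Q - c%:M) *m x0 = 0.
  have qBE x : qform (Q - c%:M) x = qform Q x - c * frob x ^+ 2.
    have -> : Q - c%:M = Q + (- c)%:M by rewrite (raddfN (@scalar_mx R n)).
    by rewrite qformD qform_scalar mulNr.
  apply: psd_null_vector => [|y|].
  - by rewrite linearB/= symQ tr_scalar_mx.
  - by rewrite qBE subr_ge0.
  - by rewrite qBE x01 mulr1 subrr.
have Qx0 : Q *m x0 = c *: x0.
  by apply/eqP; rewrite -subr_eq0 -mul_scalar_mx -mulmxBl kerx0.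
have x0N0 : x0 != 0.
  by apply: contra_eq_neq x01 => ->; rewrite frob0 expr0n eq_sym oner_neq0.
(* [eigenvalue] refers to row vectors; symmetry of [Q] turns the column eigenvector [x0] into the
   row eigenvector [v0]. *)
have Ec : [set a : R | eigenvalue Q a] c.
  apply/eigenvalueP; exists v0; last by apply: contra_neq x0N0 => v00; rewrite /x0 v00 trmx0.
  by apply: trmx_inj; rewrite trmx_mul symQ -/x0 Qx0 linearZ.
have lbE : lbound [set a : R | eigenvalue Q a] c.
  move=> a /eigenvalueP[v va v0'].
  have vp : 0 < frob v^T ^+ 2.
    rewrite exprn_gt0// lt0r frob_ge0 andbT; apply: contra_neq v0' => /frob_eq0 v0'.
    by rewrite -(trmxK v) v0' trmx0.
  have := minc v^T; rewrite qform_mxdot -[X in X *m _]symQ -trmx_mul va linearZ/= mxdotZr -sqr_frob.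
  by rewrite ler_pM2r.
have -> : lambda_min Q = c.
  apply/eqP; rewrite eq_le; apply/andP; split; last by apply: lb_le_inf => //; exists c.
  by apply: ge_inf => //; exists c.
by split => //; exact: posQ.
Qed.

(** * Cost as a series of traces, and its tails *)

Lemma ae_imply {R : realType} {d} {T : measurableType d} (P : probability T R)
    (A B : T -> Prop) :
  (forall w, A w -> B w) -> {ae P, forall w, A w} -> {ae P, forall w, B w}.
Proof. by move=> AB; apply: filterS. Qed.

Lemma ae_imply2 {R : realType} {d} {T : measurableType d} (P : probability T R)
    (A B C : T -> Prop) :
  (forall w, A w -> B w -> C w) -> {ae P, forall w, A w} -> {ae P, forall w, B w} ->
  {ae P, forall w, C w}.
Proof. by move=> ABC; apply: filterS2. Qed.

Lemma ae_bounded_integrable {R : realType} {d} {T : measurableType d}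
    (P : probability T R) (f : T -> R) (c : R) :
  measurable_fun setT f -> {ae P, forall w, `|f w| <= c} ->
  P.-integrable setT (EFin \o f).
Proof.
move=> mf fc; apply/integrableP; split; first exact/measurable_EFinP.
apply: (@le_lt_trans _ _ (\int[P]_(w in setT) (Num.max c 0)%:E)%E); last first.
  by rewrite integral_cst//= [P _]probability_setT mule1 ltry.
apply: ae_ge0_le_integral => //.
- by apply/measurableT_comp => //; exact/measurable_EFinP.
- by move=> w _; rewrite lee_fin le_max lexx orbT.
- by apply: filterS fc => w fw _; rewrite /= lee_fin le_max fw.
Qed.

Lemma mx_entries_borel {R : realType} {m n} :
  mx_entries (fun f : borel_mx R m n -> R => measurable_fun setT f) id.
Proof.
move=> i j; apply: (measurability _ (RGenOpens.measurableE R)).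
move=> _ [_ [a [b ->] <-]]; rewrite setTI; apply: sub_sigma_algebra.
by apply: open_comp => [M _|]; [exact: coord_continuous|exact: interval_open].
Qed.

Section lqr_cost.
Context {R : realType} {n m : nat}.
Variables (p : lqr R n m) (DX : R).
Hypothesis pA : lqr_assumptions p DX.
Local Notation A := (lqrA p).
Local Notation B := (lqrB p).
Local Notation Q := (lqrQ p).
Local Notation Rc := (lqrR p).
Local Notation D := (lqrD p).
Implicit Types (K : 'M[R]_(m, n)) (x : 'cV[R]_n).

(** The terms of the series for the value matrix [P_K], which solves the Lyapunov equation of the
    closed loop when [K] is stable. *)
Definition stage_mx K i : 'M[R]_n :=
  ((A - B *m K) ^+ i)^T *m (Q + K^T *m Rc *m K) *m (A - B *m K) ^+ i.

Lemma stage_costE K x i : stage_cost p K x i = qform (stage_mx K i) x.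
Proof. by rewrite qform_congr. Qed.

Lemma stage_cost_add K x h i :
  stage_cost p K x (h + i) = stage_cost p K ((A - B *m K) ^+ h *m x) i.
Proof. by rewrite /stage_cost mulmxA addnC exprD. Qed.

Lemma stateE K x i : state p K x i = (A - B *m K) ^+ i *m x.
Proof.
elim: i => [|i IH]; first by rewrite mul1mx.
by rewrite /= IH /action mulmxN (mulmxA B) -mulmxBl exprS mulmxA.
Qed.

Lemma qformN (M : 'M[R]_m) (y : 'cV[R]_m) : qform M (- y) = qform M y.
Proof. by rewrite !qformE; do 2 apply: eq_bigr => ? _; rewrite !mxE mulrNN. Qed.

Lemma running_costE K x i :
  qform Q (state p K x i) + qform Rc (action K (state p K x i)) =
  stage_cost p K x i.
Proof. by rewrite /action qformN stateE /stage_cost qformD qform_congr. Qed.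

Lemma posdef_qform_ge0 k (M : 'M[R]_k) y : sym_posdef M -> 0 <= qform M y.
Proof.
move=> [_ posM]; have [->|y0] := eqVneq y 0; last exact/ltW/posM.
by rewrite /qform mulmx0 mxE.
Qed.

Lemma stage_cost_ge_Q K x : qform Q x <= stage_cost p K x 0.
Proof.
case: pA => _ pR _ _ _.
by rewrite /stage_cost expr0 mul1mx qformD qform_congr lerDl posdef_qform_ge0.
Qed.

Lemma stage_cost_ge0 K x i : 0 <= stage_cost p K x i.
Proof.
case: pA => pQ pR _ _ _.
rewrite -(addn0 i) stage_cost_add; apply: le_trans (stage_cost_ge_Q K _).
exact: posdef_qform_ge0.
Qed.

(** The products of coordinates have the entries of the identity as means; the almost sure bound on
    the initial state makes them integrable. *)
Lemma expect_qform (M : 'M[R]_n) : (\int[D]_x (qform M x)%:E = (\tr M)%:E)%E.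
Proof.
case: pA => _ _ _ cov bnd.
have icoord i j : D.-integrable setT
    (fun x : borel_mx R n 1 => ((x : 'cV[R]_n) i 0 * (x : 'cV[R]_n) j 0)%:E).
  apply: (ae_bounded_integrable _ _ (DX ^+ 2)).
    by apply: measurable_funM; exact: mx_entries_borel.
  apply: ae_imply bnd => x xD; rewrite normrM expr2.
  by apply: ler_pM => //; apply: le_trans xD; exact: coord_le_frob.
have iM i j : D.-integrable setT
    (fun x : borel_mx R n 1 => (M i j * ((x : 'cV[R]_n) i 0 * (x : 'cV[R]_n) j 0))%:E).
  by under eq_fun do rewrite EFinM; exact: integrableZl.
under eq_integral do rewrite qformE -sumEFin.
rewrite integral_sum//; last first.
  move=> i; under eq_fun do rewrite -sumEFin.
  by apply: integrable_sum => // j _; exact: iM.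
rewrite /mxtrace -sumEFin; apply: eq_bigr => i _.
under eq_integral do rewrite -sumEFin.
rewrite integral_sum//.
under eq_bigr do (under eq_integral do rewrite EFinM); rewrite (bigD1 i)//=.
rewrite integralZl// cov eqxx mule1 big1 ?adde0// => j ji.
by rewrite integralZl// cov eq_sym (negbTE ji) mule0.
Qed.

Lemma stage_mx_trace_ge0 K i : 0 <= \tr (stage_mx K i).
Proof.
rewrite -lee_fin -expect_qform; apply: integral_ge0 => x _.
by rewrite lee_fin -stage_costE stage_cost_ge0.
Qed.

Lemma costE K : (cost p K = \sum_(0 <= i <oo) (\tr (stage_mx K i))%:E)%E.
Proof.
rewrite /cost.
under eq_integral do under eq_eseriesr do rewrite running_costE.
rewrite integral_nneseries//.
- apply: eq_eseriesr => i _; rewrite -expect_qform.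
  by apply: eq_integral => x _; rewrite stage_costE.
- move=> i; apply/measurable_EFinP.
  under eq_fun do rewrite stage_costE.
  apply: (fsubring_qform (function_subring_measurable _)).
    by apply: mx_entries_cst; exact: function_subring_measurable.
  exact: mx_entries_borel.
- by move=> i x _; rewrite lee_fin stage_cost_ge0.
Qed.

Lemma sum_trace_le_cost K N : ((\sum_(0 <= i < N) \tr (stage_mx K i))%:E <= cost p K)%E.
Proof.
rewrite costE -sumEFin; apply: nneseries_lim_ge => i _ _.
by rewrite lee_fin stage_mx_trace_ge0.
Qed.

(** A bound on a possibly infinite cost becomes a bound on finite sums that are polynomial in [K].
    This is how lower semicontinuity of the cost is used later. *)
Lemma cost_leP K (c : R) :
  (cost p K <= c%:E)%E <-> forall N, \sum_(0 <= i < N) \tr (stage_mx K i) <= c.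
Proof.
split=> [Kc N|Kc].
  by rewrite -lee_fin; exact: le_trans (sum_trace_le_cost K N) Kc.
rewrite costE; apply: lime_le.
  by apply: is_cvg_nneseries => i _ _; rewrite lee_fin stage_mx_trace_ge0.
by apply: nearW => N; rewrite sumEFin lee_fin.
Qed.

(** The partial sum is a positive semidefinite form in [x], bounded by its trace, and that trace is
    at most the cost. *)
Lemma Fhor_le K c x N : (cost p K <= c%:E)%E -> Fhor p N K x <= c * frob x ^+ 2.
Proof.
move=> /cost_leP /(_ N) Nc.
have -> : Fhor p N K x = qform (\sum_(0 <= i < N) stage_mx K i) x.
  by rewrite qform_sum; apply: eq_bigr => i _; rewrite stage_costE.
apply: (@le_trans _ _ ((\sum_(0 <= i < N) \tr (stage_mx K i)) * frob x ^+ 2)).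
  rewrite -raddf_sum; apply: qform_le_trace => y; rewrite qform_sum.
  by apply: sumr_ge0 => i _; rewrite -stage_costE stage_cost_ge0.
by rewrite ler_wpM2r// sqr_ge0.
Qed.

Section finite_cost.
Variables (K : 'M[R]_(m, n)) (c : R).
Hypothesis Kc : (cost p K <= c%:E)%E.

Lemma Finf_le x : (Finf p K x <= (c * frob x ^+ 2)%:E)%E.
Proof.
apply: lime_le.
  by apply: is_cvg_nneseries => i _ _; rewrite lee_fin stage_cost_ge0.
by apply: nearW => N; rewrite sumEFin lee_fin; exact: Fhor_le.
Qed.

Lemma Finf_ge0 x : (0 <= Finf p K x)%E.
Proof. by apply: nneseries_ge0 => i _ _; rewrite lee_fin stage_cost_ge0. Qed.

Lemma Finf_fin_num x : Finf p K x \is a fin_num.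
Proof. by rewrite ge0_fin_numE ?Finf_ge0// (le_lt_trans (Finf_le x))// ltry. Qed.

Lemma Finf_split h x :
  fine (Finf p K x) = Fhor p h K x + fine (Finf p K ((A - B *m K) ^+ h *m x)).
Proof.
apply: EFin_inj; rewrite EFinD !fineK ?Finf_fin_num//.
rewrite {1}/Finf (nneseries_split 0 h); last first.
  by move=> i _; rewrite lee_fin stage_cost_ge0.
rewrite add0n sumEFin; congr (_ + _)%E.
rewrite -(@nneseries_addn _ (fun i => (stage_cost p K x i)%:E) h)//; last first.
  by move=> i; rewrite lee_fin stage_cost_ge0.
by apply: eq_eseriesr => i _; rewrite addnC stage_cost_add.
Qed.

Hypothesis n0 : (0 < n)%N.
Local Notation lm := (lambda_min Q).

Lemma lmin_gt0 : 0 < lm.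
Proof. by case: pA => pQ _ _ _ _; case: (lambda_min_posdef _ n0 pQ). Qed.

Lemma lmin_le_Finf x : lm * frob x ^+ 2 <= fine (Finf p K x).
Proof.
case: pA => pQ _ _ _ _; case: (lambda_min_posdef _ n0 pQ) => _ /(_ x) lmx.
apply: le_trans lmx _; apply: le_trans (stage_cost_ge_Q K x) _.
rewrite (Finf_split 1) /Fhor big_nat1 lerDl fine_ge0// Finf_ge0//.
Qed.

(** Both bounds on [Finf] are compared at a basis vector. Hence the contraction factor [1 - lm / c]
    is nonnegative. *)
Lemma lmin_le_cost : lm <= c.
Proof.
pose e : 'cV[R]_n := delta_mx (Ordinal n0) 0.
have ep : 0 < frob e ^+ 2.
  rewrite exprn_gt0// lt0r frob_ge0 andbT; apply/negP => /eqP/frob_eq0/matrixP.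
  by move=> /(_ (Ordinal n0) 0); rewrite !mxE !eqxx => /eqP; rewrite oner_eq0.
rewrite -(ler_pM2r ep); apply: le_trans (lmin_le_Finf e) _.
by rewrite -lee_fin fineK ?Finf_fin_num// Finf_le.
Qed.

Lemma Finf_tail h x :
  0 <= fine (Finf p K x) - Fhor p h K x <= c * (1 - lm / c) ^+ h * frob x ^+ 2.
Proof.
have c0 : 0 < c by apply: lt_le_trans lmin_gt0 lmin_le_cost.
have Vle y : fine (Finf p K y) <= c * frob y ^+ 2.
  by rewrite -lee_fin fineK ?Finf_fin_num// Finf_le.
have r0 : 0 <= 1 - lm / c by rewrite subr_ge0 ler_pdivrMr// mul1r lmin_le_cost.
rewrite (Finf_split h) (addrC (Fhor p h K x)) addrK fine_ge0 ?Finf_ge0//=.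
apply: (@le_trans _ _ ((1 - lm / c) ^+ h * fine (Finf p K x))); last first.
  by rewrite mulrAC [leRHS]mulrC ler_wpM2l// exprn_ge0.
elim: h => [|h IH]; first by rewrite mul1mx mul1r.
rewrite exprS -mulmxA exprS -mulrA.
apply: le_trans (ler_wpM2l r0 IH).
move: (_ *m x) => y.
have := Finf_split 1 y; rewrite expr1 /Fhor big_nat1 => Vy.
have -> : fine (Finf p K ((A - B *m K) *m y)) = fine (Finf p K y) - stage_cost p K y 0.
  by rewrite Vy (addrC (stage_cost _ _ _ _)) addrK.
rewrite mulrBl mul1r lerD2l lerN2.
(* The contraction: the stage cost is at least [lm |y|^2], while [Finf] at [y] is at most
   [c |y|^2]. *)
apply: (@le_trans _ _ (lm * frob y ^+ 2)); last first.
  case: pA => pQ _ _ _ _; case: (lambda_min_posdef _ n0 pQ) => _ /(_ y) lmy.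
  exact: le_trans lmy (stage_cost_ge_Q K y).
by rewrite -mulrA ler_wpM2l ?(ltW lmin_gt0)// mulrC ler_pdivrMr// mulrC.
Qed.

End finite_cost.

End lqr_cost.

(** * Expectations of matrix-valued random variables *)

Section means.
Context {R : realType} {d} {T : measurableType d} (P : probability T R).

Lemma ae_le_Rintegral (f g : T -> R) :
  P.-integrable setT (EFin \o f) -> P.-integrable setT (EFin \o g) ->
  {ae P, forall w, f w <= g w} -> \int[P]_w f w <= \int[P]_w g w.
Proof.
move=> intf intg fg; rewrite -subr_ge0 -RintegralB//.
have intgf : P.-integrable setT (EFin \o (fun w => g w - f w)).
  by apply: (@eq_integrable _ _ _ _ _ _ ((EFin \o g) \- (EFin \o f))%E) => //; exact: integrableB.
have mgf := measurable_int _ intgf.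
rewrite /Rintegral (ae_eq_integral (fun w => `|(g w - f w)%:E|)%E)//.
- by apply: fine_ge0; exact: integral_ge0.
- exact: measurableT_comp.
- by apply: filterS fg => w fw _ /=; rewrite ger0_norm// subr_ge0.
Qed.

Lemma integrable_cst (c : R) : P.-integrable setT (EFin \o fun=> c).
Proof. exact: finite_measure_integrable_cst. Qed.

Lemma Rintegral_prob_cst (c : R) : \int[P]_w c = c.
Proof.
by rewrite Rintegral_cst//; have /= -> := probability_setT P; rewrite mulr1.
Qed.

Lemma integrable_Rsum (I : Type) (r : seq I) (F : I -> T -> R) :
  (forall i, P.-integrable setT (EFin \o F i)) ->
  P.-integrable setT (EFin \o (fun w => \sum_(i <- r) F i w)).
Proof.
move=> iF; rewrite /comp; under eq_fun do rewrite -sumEFin.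
by apply: integrable_sum => // i _; exact: iF.
Qed.

Lemma Rintegral_sum (I : Type) (r : seq I) (F : I -> T -> R) :
  (forall i, P.-integrable setT (EFin \o F i)) ->
  \int[P]_w (\sum_(i <- r) F i w) = \sum_(i <- r) \int[P]_w F i w.
Proof.
move=> iF; elim: r => [|i r IH].
  by rewrite big_nil (@eq_Rintegral _ _ _ P _ (fun=> 0)) ?Rintegral_prob_cst// => w _; rewrite big_nil.
rewrite big_cons -IH -RintegralD//; last exact: integrable_Rsum.
by apply: eq_Rintegral => w _; rewrite big_cons.
Qed.

Lemma integrableZ_R (a : R) (f : T -> R) : P.-integrable setT (EFin \o f) ->
  P.-integrable setT (EFin \o (fun w => a * f w)).
Proof. by move=> intf; rewrite /comp; under eq_fun do rewrite EFinM; exact: integrableZl. Qed.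

Context {m n : nat}.
Implicit Types X : T -> 'M[R]_(m, n).

Definition mx_mean X : 'M[R]_(m, n) := \matrix_(i, j) \int[P]_w X w i j.

Lemma mxdot_mean G X : mx_entries (fun f => P.-integrable setT (EFin \o f)) X ->
  mxdot G (mx_mean X) = \int[P]_w mxdot G (X w).
Proof.
move=> iX; rewrite /mxdot Rintegral_sum => [|i]; last first.
  by apply: integrable_Rsum => j; exact: integrableZ_R.
apply: eq_bigr => i _; rewrite Rintegral_sum => [|j]; last exact: integrableZ_R.
by apply: eq_bigr => j _; rewrite mxE RintegralZl.
Qed.

Lemma integrable_mxdot G X : mx_entries (fun f => P.-integrable setT (EFin \o f)) X ->
  P.-integrable setT (EFin \o (fun w => mxdot G (X w))).
Proof.
by move=> iX; apply: integrable_Rsum => i; apply: integrable_Rsum => j; exact: integrableZ_R.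
Qed.

Lemma mx_meanB X Y :
  mx_entries (fun f => P.-integrable setT (EFin \o f)) X ->
  mx_entries (fun f => P.-integrable setT (EFin \o f)) Y ->
  mx_mean (fun w => X w - Y w) = mx_mean X - mx_mean Y.
Proof.
move=> iX iY; apply/matrixP => i j; rewrite !mxE -RintegralB//.
by apply: eq_Rintegral => w _; rewrite !mxE.
Qed.

Lemma mx_integrableB X Y :
  mx_entries (fun f => P.-integrable setT (EFin \o f)) X ->
  mx_entries (fun f => P.-integrable setT (EFin \o f)) Y ->
  mx_entries (fun f => P.-integrable setT (EFin \o f)) (fun w => X w - Y w).
Proof.
move=> iX iY i j; have := integrableB measurableT (iX i j) (iY i j).
by apply: eq_integrable => // w _; rewrite /= !mxE.
Qed.

(** Pairing the mean with itself gives its squared norm as the expectation of its inner product with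
    [X], at most [c] times its norm by Cauchy-Schwarz. *)
Lemma frob_mean_le X c : mx_entries (fun f => P.-integrable setT (EFin \o f)) X ->
  {ae P, forall w, frob (X w) <= c} -> frob (mx_mean X) <= c.
Proof.
move=> iX Xc; have [X0|X0] := eqVneq (frob (mx_mean X)) 0.
  (* Here only [0 <= c] is at stake: [c] bounds a norm almost surely. *)
  have : \int[P]_w 0 <= \int[P]_w c.
    apply: ae_le_Rintegral; [exact: integrable_cst..|].
    by apply: filterS Xc => w; apply: le_trans; exact: frob_ge0.
  by rewrite !Rintegral_prob_cst X0.
have Xp : 0 < frob (mx_mean X) by rewrite lt0r X0 frob_ge0.
rewrite -(ler_pM2l Xp) -expr2 sqr_frob mxdot_mean//.
rewrite -[leRHS]Rintegral_prob_cst; apply: ae_le_Rintegral.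
- exact: integrable_mxdot.
- exact: integrable_cst.
- apply: filterS Xc => w Xw; apply: le_trans (mxdot_le_frob _ _) _.
  by rewrite ler_pM2l.
Qed.

Lemma mx_integrable_bounded X c :
  mx_entries (fun f : T -> R => measurable_fun setT f) X ->
  {ae P, forall w, frob (X w) <= c} ->
  mx_entries (fun f => P.-integrable setT (EFin \o f)) X.
Proof.
move=> mX Xc i j; apply: ae_bounded_integrable (mX i j) _.
by apply: filterS Xc => w; apply: le_trans; exact: coord_le_frob.
Qed.

End means.

Lemma ae_prod {R : realType} {d1 d2} {T1 : measurableType d1} {T2 : measurableType d2}
    (P1 : probability T1 R) (P2 : probability T2 R) (A : T1 -> Prop) (B : T2 -> Prop) :
  {ae P1, forall x, A x} -> {ae P2, forall y, B y} ->
  {ae (P1 \x P2)%E, forall z, A z.1 /\ B z.2}.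
Proof.
move=> [N1 [mN1 N10 sN1]] [N2 [mN2 N20 sN2]].
have neg1 : (P1 \x P2)%E.-negligible (N1 `*` [set: T2]).
  apply/negligibleP; first exact: measurableX.
  transitivity (P1 N1 * P2 setT)%E; first exact: product_measure1E.
  by rewrite N10 mul0e.
have neg2 : (P1 \x P2)%E.-negligible ([set: T1] `*` N2).
  apply/negligibleP; first exact: measurableX.
  transitivity (P1 setT * P2 N2)%E; first exact: product_measure1E.
  by rewrite N20 mule0.
apply: negligibleS (negligibleU neg1 neg2) => -[x y] /= AB.
have [Ax|nAx] := pselect (A x).
  by right; split => //; apply: sN2 => /= By; apply: AB.
by left; split => //; apply: sN1.
Qed.

Lemma ae_prob1 {R : realType} {d} {T : measurableType d} (P : probability T R) (A : set T) :
  measurable A -> P A = 1%E -> {ae P, forall x, A x}.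
Proof.
move=> mA PA; exists (~` A); split => //; first exact: measurableC.
by rewrite probability_setC// PA subee.
Qed.

(** * Perturbation of the policy *)

Section entries_of_costs.
Context {R : realType} {T : Type} {S : (T -> R) -> Prop} (subS : function_subring S).
Context {n m : nat} (p : lqr R n m).
Variables (K : T -> 'M[R]_(m, n)) (x : T -> 'cV[R]_n) (u : T -> 'M[R]_(m, n)).
Hypotheses (SK : mx_entries S K) (Sx : mx_entries S x) (Su : mx_entries S u).

Lemma mx_entries_closed_loop : mx_entries S (fun t => lqrA p - lqrB p *m K t).
Proof.
apply: (mx_entriesB subS); first exact: mx_entries_cst.
by apply: (mx_entriesM subS) => //; exact: mx_entries_cst.
Qed.

Lemma mx_entries_stage_weight :
  mx_entries S (fun t => lqrQ p + (K t)^T *m lqrR p *m K t).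
Proof.
apply: (mx_entriesD subS); first exact: mx_entries_cst.
apply: (mx_entriesM subS) => //; apply: (mx_entriesM subS); last exact: mx_entries_cst.
exact: mx_entries_tr.
Qed.

Lemma mx_entries_stage_mx i : mx_entries S (fun t => stage_mx p (K t) i).
Proof.
have SA := mx_entriesX subS _ i mx_entries_closed_loop.
apply: (mx_entriesM subS) => //; apply: (mx_entriesM subS).
  exact: mx_entries_tr.
exact: mx_entries_stage_weight.
Qed.

Lemma fsubring_stage_cost i : S (fun t => stage_cost p (K t) (x t) i).
Proof.
apply: (fsubring_qform subS); first exact: mx_entries_stage_weight.
apply: (mx_entriesM subS) => //.
exact: (mx_entriesX subS _ i mx_entries_closed_loop).
Qed.

Lemma fsubring_Fhor h : S (fun t => Fhor p h (K t) (x t)).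
Proof. by apply: (fsubring_sum subS) => i; exact: fsubring_stage_cost. Qed.

End entries_of_costs.

Lemma mx_entries_Ghor {R : realType} {T : Type} {S : (T -> R) -> Prop}
    (subS : function_subring S) {n m : nat} (p : lqr R n m) h alpha
    (K : T -> 'M[R]_(m, n)) (x : T -> 'cV[R]_n) (u : T -> 'M[R]_(m, n)) :
  mx_entries S K -> mx_entries S x -> mx_entries S u ->
  mx_entries S (fun t => Ghor p h alpha (K t) (x t) (u t)).
Proof.
move=> SK Sx Su; apply: (mx_entriesZ subS) => //.
have Sau : mx_entries S (fun t => alpha *: u t).
  by apply: (mx_entriesZ subS) => //; exact: fsubring_cst.
apply: (fsubring_mul _ subS); first exact: fsubring_cst.
have Sp : S (fun t => Fhor p h (K t + alpha *: u t) (x t)).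
  by apply: (fsubring_Fhor subS) => //; exact: mx_entriesD.
have Sm : S (fun t => (-1) * Fhor p h (K t - alpha *: u t) (x t)).
  apply: (fsubring_mul _ subS); first exact: fsubring_cst.
  by apply: (fsubring_Fhor subS) => //; exact: mx_entriesB.
have := fsubring_add _ subS _ _ Sp Sm.
by apply: fsubring_ext => t; rewrite mulN1r.
Qed.

Section measurability.
Context {R : realType} {d} {T : measurableType d} {n m : nat}.
Variables (p : lqr R n m) (DX : R).
Hypothesis pA : lqr_assumptions p DX.
Local Notation measurable_entries := (mx_entries (fun f : T -> R => measurable_fun setT f)).

(** A series of nonnegative polynomials in the entries is measurable, also where its value is
    infinite. *)
Lemma measurable_cost (K : T -> 'M[R]_(m, n)) : measurable_entries K ->
  measurable_fun setT (fun w => cost p (K w)).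
Proof.
move=> mK; under eq_fun do rewrite (costE _ _ pA).
apply: ge0_emeasurable_sum => [i w _ _|i _].
  by rewrite lee_fin (stage_mx_trace_ge0 _ _ pA).
apply/measurable_EFinP; apply: (fsubring_trace (function_subring_measurable _)).
exact: (mx_entries_stage_mx (function_subring_measurable _)).
Qed.

Lemma measurable_fine_Finf (K : T -> 'M[R]_(m, n)) (x : T -> 'cV[R]_n) :
  measurable_entries K -> measurable_entries x ->
  measurable_fun setT (fun w => fine (Finf p (K w) (x w))).
Proof.
move=> mK mx; apply: measurableT_comp => //.
apply: ge0_emeasurable_sum => [i w _ _|i _].
  by rewrite lee_fin (stage_cost_ge0 _ _ pA).
apply/measurable_EFinP.
exact: (fsubring_stage_cost (function_subring_measurable _)).
Qed.

Lemma measurable_Ginf alpha (K : T -> 'M[R]_(m, n)) (x : T -> 'cV[R]_n)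
    (u : T -> 'M[R]_(m, n)) :
  measurable_entries K -> measurable_entries x -> measurable_entries u ->
  measurable_entries (fun w => Ginf p alpha (K w) (x w) (u w)).
Proof.
move=> mK mx mu.
have subM := @function_subring_measurable R _ T.
have mau : measurable_entries (fun w => alpha *: u w).
  by apply: (mx_entriesZ subM) => //; exact: measurable_cst.
apply: (mx_entriesZ subM) => //.
apply: measurable_funM => //; apply: measurable_funB.
  by apply: measurable_fine_Finf => //; exact: (mx_entriesD subM).
by apply: measurable_fine_Finf => //; exact: (mx_entriesB subM).
Qed.

End measurability.

Section perturbation.
Context {R : realType} {n m : nat}.
Variables (p : lqr R n m) (DX fstar mu : R) (L r : R -> R).
Hypotheses (pA : lqr_assumptions p DX) (pmin : is_min_cost p fstar)
  (land : landscape_constants p fstar mu L r).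
Implicit Types K : 'M[R]_(m, n).
Local Notation gap := (gap p fstar).
Local Notation cost := (cost p).
Local Notation grad := (grad_cost p).

Lemma gap_le_cost K c : (gap K <= c%:E)%E = (cost K <= (fstar + c)%:E)%E.
Proof. by rewrite /gap leeBlDr// EFinD addeC. Qed.

Lemma gap_ge0 K : (0 <= gap K)%E.
Proof. by case: pmin => _ /(_ K); rewrite /gap sube_ge0. Qed.

Lemma gap_fin_num K c : (gap K <= c%:E)%E -> gap K \is a fin_num.
Proof. by move=> Kc; rewrite ge0_fin_numE ?gap_ge0// (le_lt_trans Kc) ?ltry. Qed.

Lemma cost_gap K c : (gap K <= c%:E)%E -> cost K = (fstar + fine (gap K))%:E.
Proof.
move=> Kc; have := gap_fin_num _ _ Kc; rewrite /gap.
case: (cost K) => [a _| |]//=; first by congr EFin; ring.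
Qed.

Lemma fine_gap_le K c : (gap K <= c%:E)%E -> fine (gap K) <= c.
Proof. by move=> Kc; rewrite -lee_fin fineK// (gap_fin_num _ _ Kc). Qed.

Lemma fine_gap_ge0 K : 0 <= fine (gap K).
Proof. by rewrite fine_ge0// gap_ge0. Qed.

Lemma gap_le_of_cost K K' c e : (gap K <= c%:E)%E ->
  (cost K' <= cost K + e%:E)%E -> (gap K' <= (fine (gap K) + e)%:E)%E.
Proof.
by move=> Kc; rewrite (cost_gap K c Kc) gap_le_cost -EFinD addrA.
Qed.

Lemma mu_gt0 : 0 < mu. Proof. by case: land. Qed.

Section level.
Variable Dl : R.
Hypothesis Dl0 : 0 < Dl.

Lemma L_gt0 : 0 < L Dl. Proof. by case: land => _ /(_ _ Dl0)[]. Qed.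
Lemma r_gt0 : 0 < r Dl. Proof. by case: land => _ /(_ _ Dl0)[]. Qed.

Lemma smoothness K K' : (gap K < Dl%:E)%E -> frob (K' - K) <= r Dl ->
  (gap K' <= (fine (gap K) + (mxdot (grad K) (K' - K)
     + L Dl / 2 * frob (K' - K) ^+ 2))%:E)%E.
Proof.
move=> KDl KK'; case: land => _ /(_ _ Dl0)[_ _ /(_ _ KDl _ KK')[_ sm] _ _].
by apply: (gap_le_of_cost _ _ _ _ (ltW KDl)); rewrite (frob_distC K').
Qed.

(** The zero perturbation in the landscape assumption. *)
Lemma stable_of_gap K : (gap K < Dl%:E)%E -> stable p K.
Proof.
move=> KDl; case: land => _ /(_ _ Dl0)[_ r0 /(_ _ KDl K)+ _ _].
by rewrite subrr frob0 => /(_ (ltW r0))[].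
Qed.

Lemma grad_bounds K : (gap K < Dl%:E)%E ->
  mu * fine (gap K) <= frob (grad K) ^+ 2 <= 2 * L Dl * fine (gap K).
Proof.
move=> KDl; case: land => _ /(_ _ Dl0)[_ _ _ /(_ _ KDl)[lo hi] _].
have gE : gap K = (fine (gap K))%:E by rewrite fineK// (gap_fin_num _ _ (ltW KDl)).
by move: lo hi; rewrite gE -!EFinM !lee_fin => -> ->.
Qed.

Lemma grad_le_GD K : (gap K < Dl%:E)%E ->
  frob (grad K) <= 2 * Num.sqrt (L Dl * Dl).
Proof.
move=> KDl; have /andP[_ hi] := grad_bounds _ KDl.
rewrite -(ler_pXn2r (n := 2))// ?nnegrE ?frob_ge0 ?mulr_ge0 ?sqrtr_ge0//.
have LD0 : 0 <= L Dl * Dl by rewrite mulr_ge0// ltW// L_gt0.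
rewrite exprMn (sqr_sqrtr LD0).
apply: le_trans hi _; have := fine_gap_le _ _ (ltW KDl); have := L_gt0.
move=> L0 gD; have : L Dl * fine (gap K) <= L Dl * Dl by rewrite ler_pM2l.
by lra.
Qed.

(** By smoothness and the gradient bound [G_Delta], the increase of the gap is at most the quantity
    that the choice of [r Dl] keeps below [Dl]. *)
Lemma perturbed_gap_lt K K' : (gap K < Dl%:E)%E -> frob (K' - K) <= r Dl ->
  (gap K' <= (2 * Dl)%:E)%E.
Proof.
move=> KDl KK'; apply: le_trans (smoothness _ _ KDl KK') _; rewrite lee_fin.
have gD := fine_gap_le _ _ (ltW KDl).
have GD := grad_le_GD _ KDl.
have dot := mxdot_le_frob (grad K) (K' - K).
case: land => _ /(_ _ Dl0)[L0 r0 _ _ rsmall].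
have F0 := frob_ge0 (K' - K).
have : frob (K' - K) ^+ 2 <= r Dl ^+ 2 by rewrite ler_pXn2r// nnegrE// ltW.
have : frob (grad K) * frob (K' - K) <= 2 * Num.sqrt (L Dl * Dl) * r Dl.
  by apply: ler_pM => //; exact: frob_ge0.
move=> h1 h2; have : L Dl / 2 * frob (K' - K) ^+ 2 <= L Dl / 2 * r Dl ^+ 2.
  by rewrite ler_pM2l// divr_gt0.
lra.
Qed.

End level.

(* At the boundary [gap K = Dl] a short gradient step moves [K] strictly inside
   the sublevel set; the bound then follows by lower semicontinuity of the cost,
   a supremum of polynomials. *)
Lemma perturbed_gap_le (Dl : R) K K' : 0 < Dl -> (gap K <= Dl%:E)%E ->
  frob (K' - K) <= r Dl -> (gap K' <= (2 * Dl)%:E)%E.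
Proof.
move=> Dl0 KDl' KK'.
have [KDlt|KDge] := ltP (gap K) (Dl%:E).
  exact: (perturbed_gap_lt _ Dl0 _ _ KDlt KK').
have KDl : gap K = Dl%:E by apply/eqP; rewrite eq_le KDl' KDge.
(* The landscape constants require a strict sublevel set; the level [2 * Dl] has [K] in its
   interior. *)
have D20 : 0 < 2 * Dl by rewrite mulr_gt0.
have KD2 : (gap K < (2 * Dl)%:E)%E by rewrite KDl lte_fin ltr_pMl// ltr1n.
have g2 : fine (gap K) = Dl by rewrite KDl.
set g := grad K.
have gN0 : 0 < frob g.
  rewrite lt0r frob_ge0 andbT; apply/eqP => g0.
  have /andP[+ _] := grad_bounds _ D20 _ KD2; rewrite -/g g0 g2 expr0n/= => h.
  by have := mulr_gt0 mu_gt0 Dl0; lra.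
have L20 := L_gt0 _ D20; have r20 := r_gt0 _ D20.
(* The first bound keeps the gradient step within the radius at level [2 * Dl]; the second makes the
   linear decrease exceed the quadratic term. *)
pose t0 := Num.min (r (2 * Dl) / frob g) (L (2 * Dl))^-1.
have t00 : 0 < t0 by rewrite lt_min divr_gt0// invr_gt0.
have inside t : 0 < t -> t <= t0 -> (gap (K' - t *: g) <= (2 * Dl)%:E)%E.
  move=> tp; rewrite le_min => /andP[tr tL].
  apply: (perturbed_gap_lt _ Dl0 (K - t *: g)); last first.
    have -> : K' - t *: g - (K - t *: g) = K' - K by rewrite opprB addrA subrK.
    exact: KK'.
  have KtK : K - t *: g - K = - (t *: g) by rewrite addrAC subrr add0r.
  have rt : frob (K - t *: g - K) <= r (2 * Dl).
    by rewrite KtK frobN frobZ gtr0_norm// -ler_pdivlMr.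
  apply: le_lt_trans (smoothness _ D20 _ _ KD2 rt) _.
  rewrite lte_fin KtK mxdotNr mxdotZr frobN frobZ gtr0_norm// -sqr_frob -/g g2.
  have : t * L (2 * Dl) <= 1 by rewrite -ler_pdivlMr// div1r.
  have : 0 < t * frob g ^+ 2 by rewrite mulr_gt0// exprn_gt0.
  rewrite exprMn; set G2 := frob g ^+ 2; set L2 := L _ => h1 h2.
  have : t * L2 * (t * G2) <= 1 * (t * G2) by rewrite ler_pM2r.
  by nra.
(* A partial sum too large at [K'] would by continuity stay too large at [K' - t *: g] for small
   positive [t], against [inside]. *)
rewrite gap_le_cost; apply/(cost_leP _ _ pA) => N; rewrite leNgt; apply/negP => bigN.
pose f (t : R) := \sum_(0 <= i < N) \tr (stage_mx p (K' - t *: g) i).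
have subC := function_subring_continuous (R := R) R.
have cf : continuous f.
  apply: (fsubring_sum subC) => i; apply: (fsubring_trace subC).
  apply: (mx_entries_stage_mx subC); apply: (mx_entriesB subC).
    exact: mx_entries_cst.
  by apply: (mx_entriesZ subC); [move=> ?; exact: cvg_id|exact: mx_entries_cst].
have f0 : fstar + 2 * Dl < f 0 by rewrite /f scale0r subr0.
have : \forall t \near (0 : R), fstar + 2 * Dl < f t.
  have cf0 : f t @[t --> (0 : R)] --> f 0 by exact: cf.
  exact: (cvgr_gt _ cf0 _ f0).
move=> /nbhs_ballP[e /= e0 ef].
pose t := Num.min (e / 2) t0.
have tp : 0 < t by rewrite lt_min t00 divr_gt0.
have te : t < e.
  by rewrite gt_min; apply/orP; left; lra.
have := ef t; rewrite /ball/= sub0r normrN gtr0_norm// => /(_ te).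
apply/negP; rewrite -leNgt.
have : (gap (K' - t *: g) <= (2 * Dl)%:E)%E by apply: inside => //; rewrite ge_min lexx orbT.
by rewrite gap_le_cost => /(cost_leP _ _ pA)/(_ N).
Qed.

End perturbation.

(** * Bias and size of the finite-horizon estimator *)

Lemma uniform_on_sphere_ae {R : realType} {m n : nat} (s : probability (borel_mx R m n) R) :
  uniform_on_sphere s -> {ae s, forall u, frob (u : 'M[R]_(m, n)) = 1}.
Proof.
move=> [s1 _]; apply: ae_prob1 s1.
have mf : measurable_fun setT (fun u : borel_mx R m n => mxdot (u : 'M[R]_(m, n)) u).
  apply: (fsubring_mxdot (function_subring_measurable _)); exact: mx_entries_borel.
rewrite (_ : [set u | _] = setT `&` (fun u : borel_mx R m n => mxdot (u : 'M[R]_(m, n)) u) @^-1` [set 1]).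
  exact: mf.
rewrite setTI; apply/seteqP; split => u /=.
  by rewrite -sqr_frob => ->; rewrite expr1n.
by move=> u1; rewrite /frob u1 sqrtr1.
Qed.

Lemma tail_difference_le {R : realDomainType} (a b c e g k : R) :
  0 <= a - c -> a - c <= g -> 0 <= b - e -> b - e <= g -> g <= k ->
  `|c - e - (a - b)| <= k.
Proof. by move=> *; rewrite ler_norml; apply/andP; split; lra. Qed.

Section finite_horizon_estimator.
Context {R : realType} {n m : nat}.
Variables (p : lqr R n m) (DX fstar mu : R) (L r l : R -> R).
Variable s : probability (borel_mx R m n) R.
Hypotheses (pA : lqr_assumptions p DX) (pmin : is_min_cost p fstar)
  (sU : uniform_on_sphere s)
  (land : landscape_constants p fstar mu L r)
  (est : estimator_constants p s fstar L r l) (n0 : (0 < n)%N).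
Local Notation D := (lqrD p).
Local Notation gap := (gap p fstar).
Local Notation dim := ((m * n)%:R : R).
Variables (Dl alpha : R) (h : nat).
Hypotheses (Dl0 : 0 < Dl) (a0 : 0 < alpha) (ar : alpha <= r Dl).
Let f2 := fstar + 2 * Dl.
Let epsh := dim * f2 * DX ^+ 2 / (2 * alpha) * (1 - lambda_min (lqrQ p) / f2) ^+ h.

Lemma good_sample :
  {ae (D \x s)%E, forall z, frob (z.1 : 'cV[R]_n) <= DX /\ frob (z.2 : 'M[R]_(m, n)) = 1}.
Proof.
apply: (ae_prod D s (fun x => frob (x : 'cV[R]_n) <= DX)
  (fun u => frob (u : 'M[R]_(m, n)) = 1)).
  by case: pA.
exact: uniform_on_sphere_ae.
Qed.

(** Both perturbed policies cost at most [f2], so both tails lie in one interval [[0, k]] and differ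
    by at most [k], not [2 k]. *)
Lemma truncation_error (K : 'M[R]_(m, n)) x u :
  (gap K <= Dl%:E)%E -> frob x <= DX -> frob u = 1 ->
  frob (Ghor p h alpha K x u - Ginf p alpha K x u) <= epsh.
Proof.
move=> KDl xD u1.
have near_cost (K' : 'M[R]_(m, n)) : frob (K' - K) <= alpha -> (cost p K' <= f2%:E)%E.
  move=> K'a; rewrite -gap_le_cost.
  apply: (perturbed_gap_le _ _ _ _ _ _ pA pmin land _ _ _ Dl0 KDl).
  exact: le_trans K'a ar.
have au : frob (alpha *: u) = alpha by rewrite frobZ u1 mulr1 gtr0_norm.
have cp : (cost p (K + alpha *: u) <= f2%:E)%E.
  by apply: near_cost; rewrite addrAC subrr add0r au.
have cm : (cost p (K - alpha *: u) <= f2%:E)%E.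
  by apply: near_cost; rewrite addrAC subrr add0r frobN au.
have /andP[tp0 tp] := Finf_tail _ _ pA _ _ cp n0 h x.
have /andP[tm0 tm] := Finf_tail _ _ pA _ _ cm n0 h x.
rewrite /Ghor /Ginf -scalerBl -mulrBr frobZ u1 mulr1 normrM.
set rho := 1 - _ / _ in tp tm *.
have f20 : 0 < f2.
  exact: lt_le_trans (lmin_gt0 _ _ pA n0) (lmin_le_cost _ _ pA _ _ cp n0).
have rho0 : 0 <= rho.
  rewrite /rho subr_ge0 ler_pdivrMr// mul1r.
  exact: (lmin_le_cost _ _ pA _ _ cp n0).
have x2 : frob x ^+ 2 <= DX ^+ 2.
  by rewrite ler_pXn2r// nnegrE ?frob_ge0// (le_trans _ xD)// frob_ge0.
have T0 : 0 <= f2 * rho ^+ h by rewrite mulr_ge0 ?(ltW f20)// exprn_ge0.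
have TX := ler_wpM2l T0 x2.
have -> : epsh = dim / (2 * alpha) * (f2 * rho ^+ h * DX ^+ 2).
  by rewrite /epsh -/rho; ring.
rewrite ger0_norm; last by rewrite divr_ge0// mulr_ge0// ltW.
apply: ler_wpM2l; first by rewrite divr_ge0// mulr_ge0// ltW.
exact: tail_difference_le tp0 tp tm0 tm TX.
Qed.

Lemma Ghor_bounded (K : 'M[R]_(m, n)) : (gap K <= Dl%:E)%E ->
  {ae (D \x s)%E, forall z, frob (Ghor p h alpha K z.1 z.2) <= dim * l Dl + epsh}.
Proof.
move=> KDl; have [_ /(_ alpha K a0 ar KDl)[_ _ Gl]] := est Dl Dl0.
apply: (ae_imply2 _ _ _ _ _ Gl good_sample) => z Gz [xD u1].
have E (X Y : 'M[R]_(m, n)) : X = Y + (X - Y) by rewrite addrCA subrr addr0.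
rewrite (E (Ghor p h alpha K z.1 z.2) (Ginf p alpha K z.1 z.2)).
by apply: le_trans (frobD _ _) _; apply: lerD => //; exact: truncation_error.
Qed.

Lemma measurable_sample1 :
  mx_entries (fun f : borel_mx R n 1 * borel_mx R m n -> R => measurable_fun setT f)
    (fun z => z.1 : 'cV[R]_n).
Proof. by move=> i j; exact: (measurableT_comp (mx_entries_borel i j) measurable_fst). Qed.

Lemma measurable_sample2 :
  mx_entries (fun f : borel_mx R n 1 * borel_mx R m n -> R => measurable_fun setT f)
    (fun z => z.2 : 'M[R]_(m, n)).
Proof. by move=> i j; exact: (measurableT_comp (mx_entries_borel i j) measurable_snd). Qed.

Lemma measurable_Ghor_sample (K : 'M[R]_(m, n)) :
  mx_entries (fun f : borel_mx R n 1 * borel_mx R m n -> R => measurable_fun setT f)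
    (fun z => Ghor p h alpha K z.1 z.2).
Proof.
apply: (mx_entries_Ghor (function_subring_measurable _)).
- by apply: mx_entries_cst; exact: function_subring_measurable.
- exact: measurable_sample1.
- exact: measurable_sample2.
Qed.

(** The bias splits into that of the infinite-horizon estimator and the mean of the truncation
    error. *)
Lemma mean_Ghor_bias (K : 'M[R]_(m, n)) : (gap K <= Dl%:E)%E ->
  frob (mx_mean (D \x s)%E (fun z => Ghor p h alpha K z.1 z.2) - grad_cost p K)
    <= L Dl * alpha + epsh.
Proof.
move=> KDl; have [_ /(_ alpha K a0 ar KDl)[bias _ Gl]] := est Dl Dl0.
set mG := mx_mean _ _.
have E (X Y Z : 'M[R]_(m, n)) : X - Z = (Y - Z) + (X - Y).
  by rewrite [RHS]addrC addrA subrK.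
rewrite (E mG (mean_Ginf p s alpha K)).
apply: le_trans (frobD _ _) _; apply: lerD => //.
have iG := mx_integrable_bounded _ _ _ (measurable_Ghor_sample K) (Ghor_bounded K KDl).
have iGi := mx_integrable_bounded _ _ _ (measurable_Ginf _ _ pA _ _ _ _
   (mx_entries_cst (function_subring_measurable _) K) measurable_sample1 measurable_sample2) Gl.
rewrite -[mean_Ginf _ _ _ _]/(mx_mean (D \x s)%E (fun z => Ginf p alpha K z.1 z.2)).
rewrite -mx_meanB//; apply: frob_mean_le.
  exact: mx_integrableB.
apply: ae_imply good_sample => z [xD u1]; exact: truncation_error.
Qed.

End finite_horizon_estimator.

(** * One step of the exponential potential *)

(** From [exp x <= 1 / (1 - x)] and [(1 - x) (1 + x + 2 x^2) = 1 + x^2 (1 - 2 x)]. *)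
Lemma expR_le_quadratic {R : realType} (x : R) : x <= 2^-1 ->
  expR x <= 1 + x + 2 * x ^+ 2.
Proof.
move=> x2; have x1 : 0 < 1 - x by lra.
have : 1 - x <= expR (- x) by exact: expR_ge1Dx.
rewrite expRN -(invrK (1 - x)) lef_pV2 ?posrE ?invr_gt0 ?expR_gt0// => h.
apply: le_trans h _; rewrite -div1r ler_pdivrMr//.
by have := sqr_ge0 x; nra.
Qed.

Lemma drift_absorb {R : realFieldType} (y c t d e : R) : 2 * t <= d -> 0 < e ->
  y - c + t - d / 2 - e / 4 <= y - c.
Proof. by move=> *; lra. Qed.

(** With [d] the gap and [t = a / q], the positive terms are at most [q d + t <= 2 a + a], whence
    the condition [3 * a <= c]. *)
Lemma drift_small {R : realFieldType} (q d e a t c : R) : 1 <= q -> 0 <= d -> 0 < e ->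
  t <= a -> q * d <= 2 * a -> 3 * a <= c ->
  (q - 1) * (d - e / 2) - c + t - d / 2 - e / 4 <= 0.
Proof.
move=> q1 d0 e0 ta qd ac.
have : 0 <= (q - 1) * (e / 2) by rewrite mulr_ge0 ?subr_ge0// ltW// divr_gt0.
rewrite mulrBr mulrBl mul1r; lra.
Qed.

Section exponential_potential.
Context {R : realType} {n m : nat}.
Variables (p : lqr R n m) (DX fstar mu : R) (L r : R -> R).
Hypotheses (pA : lqr_assumptions p DX) (pmin : is_min_cost p fstar)
  (land : landscape_constants p fstar mu L r).
Local Notation gap := (gap p fstar).
Local Notation grad := (grad_cost p).
Variables (eps theta C0 : R).

(* Equal to [+oo] when the gap is infinite, to the exponential otherwise. *)
Definition potential (q : R) (K : 'M[R]_(m, n)) : \bar R :=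
  ((expR (theta * (q * (fine (gap K) - eps / 2) - C0)))%:E +
   (\1_[set +oo%E] (gap K) : R)%:E * +oo)%E.

Lemma potential_ge0 q K : (0 <= potential q K)%E.
Proof.
by rewrite adde_ge0// ?lee_fin ?expR_ge0// mule_ge0// lee_fin.
Qed.

Lemma potential_fin q K : gap K \is a fin_num ->
  potential q K = (expR (theta * (q * (fine (gap K) - eps / 2) - C0)))%:E.
Proof.
move=> gK; rewrite /potential indicE memNset ?mul0e ?adde0//= => gy.
by move: gK; rewrite gy.
Qed.

Lemma potential_pinfty q K : gap K = +oo%E -> potential q K = +oo%E.
Proof.
by move=> gK; rewrite /potential gK indicE mem_set//= mul1e addey.
Qed.

Lemma measurable_potential {d} {T : measurableType d} q (K : T -> 'M[R]_(m, n)) :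
  mx_entries (fun f : T -> R => measurable_fun setT f) K ->
  measurable_fun setT (fun w => potential q (K w)).
Proof.
move=> mK.
have mgap : measurable_fun setT (fun w => gap (K w)).
  by apply: emeasurable_funB => //; exact: (measurable_cost _ _ pA).
apply: emeasurable_funD.
  apply/measurable_EFinP; apply: (measurableT_comp (@measurable_expR R)).
  apply: measurable_funM => //; apply: measurable_funB => //.
  apply: measurable_funM => //; apply: measurable_funB => //.
  exact: measurableT_comp.
apply: emeasurable_funM => //; apply/measurable_EFinP.
by apply: (measurableT_comp _ mgap); exact: measurable_indic.
Qed.

Variables (Dl b M : R).
Hypotheses (Dl0 : 0 < Dl) (M0 : 0 < M).
Let GD := 2 * Num.sqrt (L Dl * Dl).
(** For [eta = 2 / (mu q)], the second-order term [L / 2 (eta M)^2] of smoothness, multiplied by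
    [q], is [a / q]. *)
Let a := 2 * L Dl * M ^+ 2 / mu ^+ 2.
Hypotheses (bGD : GD * b <= mu * eps / 8) (eps0 : 0 < eps)
  (thetaE : theta = mu / (16 * (M + GD) ^+ 2)) (C0a : 3 * a <= C0).

Let mu0 : 0 < mu. Proof. exact: mu_gt0 land. Qed.
Let GD0 : 0 <= GD. Proof. by rewrite mulr_ge0 ?sqrtr_ge0. Qed.
Let theta0 : 0 < theta.
Proof. by rewrite thetaE divr_gt0 ?mulr_gt0 ?exprn_gt0 ?ltr_wpDr. Qed.

(** Makes the second-order term of the exponential at most a quarter of the gradient drift. *)
Lemma theta_M2 : 16 * theta * M ^+ 2 <= mu.
Proof.
have MG : 0 < (M + GD) ^+ 2 by rewrite exprn_gt0// ltr_wpDr.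
rewrite thetaE.
have -> : 16 * (mu / (16 * (M + GD) ^+ 2)) * M ^+ 2 = mu * M ^+ 2 / (M + GD) ^+ 2.
  by field; rewrite gt_eqF// ltr_wpDr.
rewrite ler_pdivrMr// ler_pM2l// ler_pXn2r ?nnegrE ?addr_ge0 ?(ltW M0)//.
by rewrite lerDl.
Qed.

(** Keeps the random part of the exponent in the range of [expR_le_quadratic]. *)
Lemma theta_GDM : 2 * theta / mu * (GD * M) <= 2^-1.
Proof.
have MG : 0 < (M + GD) ^+ 2 by rewrite exprn_gt0// ltr_wpDr.
rewrite thetaE.
have -> : 2 * (mu / (16 * (M + GD) ^+ 2)) / mu * (GD * M) = GD * M / (8 * (M + GD) ^+ 2).
  by field; rewrite !gt_eqF// ltr_wpDr.
rewrite ler_pdivrMr; last by rewrite mulr_gt0.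
by have := mulr_ge0 (ltW M0) GD0; have := sqr_ge0 GD; have := sqr_ge0 M; nra.
Qed.

(* The exponent left after integrating one step: either the drift [- gap / 2]
   absorbs the noise term [a / q], or the gap is so small that the exponent is
   nonpositive. *)
Lemma exponent_drift (q dK g2 : R) : 1 <= q -> 0 <= dK -> mu * dK <= g2 ->
  expR (theta * (q * (dK - eps / 2) + a / q - C0) - 3 / 2 * theta / mu * g2
        + theta * eps / 4)
  <= 1 + expR (theta * ((q - 1) * (dK - eps / 2) - C0)).
Proof.
move=> q1 dK0 g2d; have q0 : 0 < q by lra.
have a0 : 0 <= a.
  by rewrite divr_ge0 ?sqr_ge0// !mulr_ge0 ?sqr_ge0// ltW// (L_gt0 _ _ _ _ _ land).
have aq : a / q <= a by rewrite ler_pdivrMr// ler_peMr.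
have aq0 : 0 <= a / q by rewrite divr_ge0// ltW.
have g2' : dK <= g2 / mu by rewrite ler_pdivlMr// mulrC.
set x := _ + _ * eps / 4.
have xle : x <= theta * ((q - 1) * (dK - eps / 2) - C0 + a / q - dK / 2 - eps / 4).
  have -> : x = theta * (q * (dK - eps / 2) + a / q - C0 - 3 / 2 * (g2 / mu) + eps / 4).
    by rewrite /x; field; rewrite ?gt_eqF.
  rewrite ler_pM2l// -subr_ge0.
  suff -> : (q - 1) * (dK - eps / 2) - C0 + a / q - dK / 2 - eps / 4 -
      (q * (dK - eps / 2) + a / q - C0 - 3 / 2 * (g2 / mu) + eps / 4) =
      3 / 2 * (g2 / mu - dK) by rewrite mulr_ge0// subr_ge0.
  by field; rewrite !gt_eqF.
have qaq : q * (a / q) = a by rewrite mulrCA divff ?mulr1// gt_eqF.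
move: aq aq0 qaq xle; move: (a / q) => t ta t0 qt xle.
have [d2|d2] := leP (2 * t) dK.
  apply: (@le_trans _ _ (expR (theta * ((q - 1) * (dK - eps / 2) - C0)))); last by rewrite lerDr.
  by rewrite ler_expR; apply: le_trans xle _; rewrite ler_pM2l//; exact: drift_absorb.
apply: (@le_trans _ _ 1); last by rewrite lerDl expR_ge0.
rewrite -expR0 ler_expR; apply: le_trans xle _.
rewrite pmulr_rle0//.
apply: (drift_small _ _ _ a) => //.
by rewrite -qt mulrCA ler_pM2l// ltW.
Qed.

Lemma potential_step {d} {Z : measurableType d} (P : probability Z R)
    (X : Z -> 'M[R]_(m, n)) (K : 'M[R]_(m, n)) (q : R) :
  1 <= q -> 2 / (mu * q) * M <= r Dl -> (gap K < Dl%:E)%E ->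
  mx_entries (fun f : Z -> R => measurable_fun setT f) X ->
  {ae P, forall z, frob (X z) <= M} ->
  frob (mx_mean P X - grad K) <= b ->
  (\int[P]_z potential q (K - (2 / (mu * q)) *: X z) <=
     1 + potential (q - 1) K)%E.
Proof.
move=> q1 etaM KDl mX XM bias; have q0 : 0 < q by lra.
have subM := @function_subring_measurable R _ Z.
set eta := 2 / (mu * q) in etaM *.
have eta0 : 0 < eta by rewrite divr_gt0// mulr_gt0.
set g := grad K; set dK := fine (gap K).
have gK : gap K \is a fin_num := gap_fin_num _ _ pmin _ _ (ltW KDl).
have /andP[glo ghi] := grad_bounds _ _ _ _ _ pmin land _ Dl0 _ KDl.
have gGD : frob g <= GD := grad_le_GD _ _ _ _ _ pmin land _ Dl0 _ KDl.
have g0 := frob_ge0 g.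
have L0 := L_gt0 _ _ _ _ _ land _ Dl0.
pose c := 2 * theta / mu.
have c0 : 0 < c by rewrite divr_gt0// mulr_gt0.
(* The random part of the exponent, with [c = theta q eta] independent of [q]; [B] collects the
   deterministic part, including the noise term [a / q]. *)
pose Y z := - (c * mxdot g (X z)).
pose B := theta * (q * (dK - eps / 2) + a / q - C0).
have iX := mx_integrable_bounded _ _ _ mX XM.
have mY : measurable_fun setT Y.
  apply: measurable_funN; apply: measurable_funM => //.
  exact: (fsubring_mxdot subM _ _ (mx_entries_cst subM g) mX).
have Ybnd : {ae P, forall z, `|Y z| <= c * (frob g * M)}.
  apply: filterS XM => z Xz; rewrite normrN normrM gtr0_norm// ler_pM2l//.
  by apply: le_trans (norm_mxdot_le _ _) _; rewrite ler_wpM2l.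
have cgM : c * (frob g * M) <= 2^-1.
  by apply: le_trans theta_GDM; rewrite ler_pM2l// ler_wpM2r// ltW.
have step z : frob (X z) <= M ->
    (potential q (K - eta *: X z) <= (expR B * expR (Y z))%:E)%E.
  move=> Xz; set K' := K - _.
  have K'K : K' - K = - (eta *: X z) by rewrite /K' addrAC subrr add0r.
  have fK' : frob (K' - K) <= eta * M.
    by rewrite K'K frobN frobZ gtr0_norm// ler_pM2l.
  have := smoothness _ _ _ _ _ pmin land _ Dl0 _ _ KDl (le_trans fK' etaM).
  rewrite -/dK -/g => sm.
  rewrite potential_fin ?(gap_fin_num _ _ pmin _ _ sm)// lee_fin -expRD ler_expR.
  have gK' := fine_gap_le _ _ pmin _ _ sm.
  have f2 : frob (K' - K) ^+ 2 <= (eta * M) ^+ 2.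
    by rewrite ler_pXn2r// nnegrE ?frob_ge0// mulr_ge0// ltW.
  have L2 : L Dl / 2 * frob (K' - K) ^+ 2 <= L Dl / 2 * (eta * M) ^+ 2.
    by rewrite ler_pM2l// divr_gt0.
  have gK'2 : fine (gap K') <= dK - eta * mxdot g (X z) + L Dl / 2 * (eta * M) ^+ 2.
    apply: le_trans gK' _; rewrite -[leRHS]addrA; apply: lerD => //; apply: lerD => //.
    by rewrite K'K mxdotNr mxdotZr.
  have -> : B + Y z = theta * (q * (dK - eta * mxdot g (X z)
      + L Dl / 2 * (eta * M) ^+ 2 - eps / 2) - C0).
    by rewrite /B /Y /c /a /eta; field; rewrite !gt_eqF.
  by rewrite ler_pM2l// lerD2r ler_pM2l// lerD2r.
have mexpY : measurable_fun setT (fun z => expR B * expR (Y z)).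
  by apply: measurable_funM => //; exact: measurableT_comp.
have ibig : P.-integrable setT (EFin \o (fun z => expR B * expR (Y z))).
  apply: (ae_bounded_integrable _ _ (expR B * expR 2^-1)) => //.
  apply: filterS Ybnd => z Yz; rewrite ger0_norm ?mulr_ge0 ?expR_ge0//.
  rewrite ler_pM2l ?expR_gt0// ler_expR (le_trans _ cgM)//.
  exact: le_trans (ler_norm _) Yz.
have mpot : measurable_fun setT (fun z => potential q (K - eta *: X z)).
  apply: measurable_potential; apply: (mx_entriesB subM (fun=> K)).
    exact: (mx_entries_cst subM).
  by apply: (mx_entriesZ subM (fun=> eta)) => //; exact: measurable_cst.
apply: (@le_trans _ _ (\int[P]_z (expR B * expR (Y z))%:E)%E).
  apply: ae_ge0_le_integral => //.
  - by move=> z _; exact: potential_ge0.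
  - exact/measurable_EFinP.
  - by apply: filterS XM => z Xz _; exact: step.
rewrite -[leLHS]fineK; last exact: integrable_fin_num.
rewrite potential_fin// lee_fin -/dK.
have idot := integrable_mxdot P g _ iX.
have iY : P.-integrable setT (EFin \o Y).
  apply: eq_integrable (integrableZ_R P (- c) _ idot) => // z _.
  by rewrite /= mulNr.
(* An almost sure bound on [2 Y^2]; only the linear term of the exponential then remains to be
   averaged. *)
pose k := 2 * (c * (frob g * M)) ^+ 2.
have ilin : P.-integrable setT (EFin \o (fun z => (1 + k) + Y z)).
  have := integrableD measurableT (integrable_cst P (1 + k)) iY.
  by apply: eq_integrable.
have : \int[P]_z (expR B * expR (Y z)) <= \int[P]_z (expR B * (1 + k + Y z)).
  apply: ae_le_Rintegral => //; first exact: integrableZ_R.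
  apply: filterS Ybnd => z Yz; rewrite ler_pM2l ?expR_gt0//.
  apply: le_trans (expR_le_quadratic _ _) _.
    by apply: le_trans cgM; exact: le_trans (ler_norm _) Yz.
  rewrite addrAC lerD2r lerD2l /k ler_pM2l// -(real_normK (num_real (Y z))).
  by rewrite ler_pXn2r ?nnegrE ?normr_ge0 ?(le_trans (normr_ge0 _) Yz).
rewrite [X in _ <= X -> _]RintegralZl// [X in _ <= _ * X -> _]RintegralD//; last first.
  exact: integrable_cst.
rewrite Rintegral_prob_cst.
have EY : \int[P]_z Y z = - (c * mxdot g (mx_mean P X)).
  rewrite mxdot_mean// -mulNr -RintegralZl//.
  by apply: eq_Rintegral => z _; rewrite mulNr.
rewrite EY => /le_trans; apply.
have dotm : frob g ^+ 2 - mu * eps / 8 <= mxdot g (mx_mean P X).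
  have -> : mxdot g (mx_mean P X) = frob g ^+ 2 + mxdot g (mx_mean P X - g).
    by rewrite mxdotBr sqr_frob addrC subrK.
  rewrite lerD2l lerNl -mxdotNr; apply: le_trans (mxdot_le_frob _ _) _.
  rewrite frobN; apply: le_trans bGD; apply: ler_pM => //; exact: frob_ge0.
have kle : k <= theta / (2 * mu) * frob g ^+ 2.
  have -> : k = 16 * theta * M ^+ 2 * (theta / (2 * mu ^+ 2) * frob g ^+ 2).
    by rewrite /k /c; field; rewrite gt_eqF.
  have -> : theta / (2 * mu) * frob g ^+ 2 = mu * (theta / (2 * mu ^+ 2) * frob g ^+ 2).
    by field; rewrite gt_eqF.
  apply: ler_wpM2r theta_M2; rewrite mulr_ge0 ?sqr_ge0// divr_ge0 ?(ltW theta0)//.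
  by rewrite mulr_ge0 ?sqr_ge0.
apply: le_trans (exponent_drift q dK (frob g ^+ 2) q1 (fine_gap_ge0 _ _ pmin _) glo).
rewrite -/B -!addrA expRD ler_pM2l ?expR_gt0//.
apply: le_trans (expR_ge1Dx _); rewrite lerD2l.
have cd : c * (frob g ^+ 2 - mu * eps / 8) <= c * mxdot g (mx_mean P X) by rewrite ler_pM2l.
have E1 : c * (frob g ^+ 2 - mu * eps / 8) = 2 * theta / mu * frob g ^+ 2 - theta * eps / 4.
  by rewrite /c; field; rewrite gt_eqF.
rewrite E1 in cd.
(* Of the drift [2 theta / mu |g|^2], the part [theta / (2 mu) |g|^2] pays for [k]; the remaining
   [3 / 2] is what [exponent_drift] expects. *)
have E2 : theta / (2 * mu) * frob g ^+ 2 = 2 * theta / mu * frob g ^+ 2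
    - 3 / 2 * theta / mu * frob g ^+ 2 by field; rewrite gt_eqF.
rewrite E2 in kle.
lra.
Qed.

End exponential_potential.

(** Used for integrability along the run even after it has left the sublevel set: each iterate is
    obtained by finitely many polynomial operations on almost surely bounded samples. *)
Lemma function_subring_ae_bounded {R : realType} {d} {T : measurableType d}
    (P : probability T R) :
  function_subring (fun f : T -> R => exists c, {ae P, forall w, `|f w| <= c}).
Proof.
split=> [c|f g [a fa] [b gb]|f g [a fa] [b gb]].
- by exists `|c|; apply: aeW => w.
- exists (a + b); apply: (ae_imply2 _ _ _ _ _ fa gb) => w fw gw.
  by apply: le_trans (ler_normD _ _) _; exact: lerD.
- exists (a * b); apply: (ae_imply2 _ _ _ _ _ fa gb) => w fw gw.
  by rewrite normrM ler_pM.
Qed.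

Lemma ae_law {R : realType} {d d'} {T : measurableType d} {T' : measurableType d'}
    (P : probability T R) (P' : probability T' R) (X : T -> T') (A : T' -> Prop) :
  measurable_fun setT X ->
  (forall S, measurable S -> P (X @^-1` S) = P' S) ->
  {ae P', forall v, A v} -> {ae P, forall w, A (X w)}.
Proof.
move=> mX law [N [mN N0 sN]]; exists (X @^-1` N); split.
- by rewrite -[X in measurable X]setTI; exact: mX.
- by rewrite law.
- by move=> w /= nA; exact: sN.
Qed.

(* The weight [Lam * P (escaped before t) + E [phi t; not escaped]] grows by at most
   [1] at each step. *)
Lemma escape_probability {R : realType} {d} {T : measurableType d} (P : probability T R)
    (E : nat -> set T) (phi : nat -> T -> \bar R) (Lam : R) (n : nat) :
  0 <= Lam ->
  (forall t, (t <= n)%N -> measurable (E t)) ->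
  (forall t, (t <= n)%N -> measurable_fun setT (phi t)) ->
  (forall t w, (0 <= phi t w)%E) ->
  E 0%N = setT -> (forall w, (phi 0%N w <= 1)%E) ->
  (forall t, (t < n)%N -> E t.+1 `<=` E t) ->
  (forall t w, (t < n)%N -> E t w -> ~ E t.+1 w -> (Lam%:E <= phi t.+1 w)%E) ->
  (forall t, (t < n)%N ->
    \int[P]_(w in E t) phi t.+1 w <= 1 + \int[P]_(w in E t) phi t w)%E ->
  (Lam%:E * P (~` E n) <= (n.+1)%:R%:E)%E.
Proof.
move=> Lam0 mE mphi phi0 E0 phi1 dE esc step.
suff H t : (t <= n)%N ->
    (Lam%:E * P (~` E t) + \int[P]_(w in E t) phi t w <= (t.+1)%:R%:E)%E.
  apply: le_trans (H n (leqnn n)); rewrite leeDl//.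
  by apply: integral_ge0 => w _; exact: phi0.
elim: t => [_|t IH tn].
  rewrite E0 setCT measure0 mule0 add0e.
  apply: (@le_trans _ _ (\int[P]_(w in setT) (cst 1%E) w)%E).
    by apply: ge0_le_integral => //; exact: mphi.
  by rewrite integral_cst//= mul1e; exact: probability_le1.
have mEt := mE t (ltnW tn); have mEt1 := mE _ tn; have mp := mphi _ tn.
have mD : measurable (E t `\` E t.+1) by exact: measurableD.
have split_E : E t = E t.+1 `|` (E t `\` E t.+1).
  by rewrite setDUK//; exact: dE.
have split_int : (\int[P]_(w in E t) phi t.+1 w = \int[P]_(w in E t.+1) phi t.+1 w
    + \int[P]_(w in E t `\` E t.+1) phi t.+1 w)%E.
  rewrite {1}split_E ge0_integral_setU//.
  - by apply: measurable_funTS.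
  - by apply/disj_setPS => w [? []].
(* The weight carried by the paths that leave at this step pays for their share of the escaped
   mass. *)
have big : (Lam%:E * P (E t `\` E t.+1) <= \int[P]_(w in E t `\` E t.+1) phi t.+1 w)%E.
  rewrite -integral_cst//; apply: ge0_le_integral => //.
  - by apply: measurable_funTS.
  - by move=> w [Ew nEw]; exact: esc.
have splitC : P (~` E t.+1) = (P (~` E t) + P (E t `\` E t.+1))%E.
  rewrite -measureU//; last 2 first.
  - exact: measurableC.
  - by apply/seteqP; split => // w [/= nE []].
  congr (P _); apply/seteqP; split => w /=.
    by move=> nE; have [?|?] := pselect (E t w); [right|left].
  by move=> [nEt Et1|[_ nE] //]; apply: nEt; exact: dE Et1.
rewrite splitC ge0_muleDr ?measure_ge0// -addeA.
apply: (@le_trans _ _ (Lam%:E * P (~` E t) + (1 + \int[P]_(w in E t) phi t w))%E).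
  apply: leeD2l; rewrite addeC; apply: le_trans _ (step _ tn).
  by rewrite split_int; apply: leeD2l.
rewrite addeCA -[X in (_ <= X)%E]/((1 + t.+1)%:R%:E) natrD EFinD.
by apply: leeD2l; apply: IH; exact: ltnW.
Qed.

(** * Stochastic policy gradient *)

Section spg.
Context {R : realType} {n m : nat} {d : measure_display} {Omega : measurableType d}.
Variables (p : lqr R n m) (DX fstar : R) (s : probability (borel_mx R m n) R).
Variables (P : probability Omega R) (h : nat) (alpha : R) (K0 : 'M[R]_(m, n))
  (eta : nat -> R) (T : nat) (F : nat -> set (set Omega))
  (x : nat -> Omega -> borel_mx R n 1) (U : nat -> Omega -> borel_mx R m n)
  (K : nat -> Omega -> 'M[R]_(m, n)).
Hypotheses (pA : lqr_assumptions p DX) (sU : uniform_on_sphere s)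
  (run : spg_run p s P h alpha K0 eta T F x U K).
Local Notation D := (lqrD p).
Local Notation Z := (borel_mx R n 1 * borel_mx R m n)%type.
Local Notation TF t := (g_sigma_algebraType (F t)).

Let sample t w : Z := (x t w, U t w).

Let G t w := Ghor p h alpha (K t w) (x t w) (U t w).

Let measurable_sample t : (t < T)%N -> measurable_fun setT (sample t).
Proof.
move=> tT; apply: measurable_fun_pair.
  exact: (spg_meas_x run).
exact: (spg_meas_U run).
Qed.

Let sub_sigma t : (t <= T)%N -> Defs.sub_sigma_algebra (F t).
Proof. exact: (spg_sub_sigma run). Qed.

Let sample_indep t : (t < T)%N -> forall E S, F t E -> measurable S ->
  P (E `&` sample t @^-1` S) = (P E * (D \x s)%E S)%E.
Proof.
move=> tT E S FE mS.
have [_ /(_ _ FE) mE] := sub_sigma t (ltnW tT).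
apply: independent_pair_law => //.
- exact: (spg_meas_x run).
- exact: (spg_meas_U run).
- move=> A B mA mB.
  rewrite setIC (spg_indep run)// muleC.
  by rewrite (spg_law_x run)// (spg_law_U run).
Qed.

Lemma iterate_measurable t : (t <= T)%N ->
  mx_entries (fun f : TF t -> R => measurable_fun setT f) (K t).
Proof.
move=> tT i j.
have mK : measurable_fun setT (K t : TF t -> borel_mx R m n).
  apply/(measurable_fun_sub_sigmaP _ (sub_sigma t tT)).
  exact: (spg_adapted run).
exact: (measurableT_comp (mx_entries_borel i j) mK).
Qed.

Lemma iterate_measurable_ambient t : (t <= T)%N ->
  mx_entries (fun f : Omega -> R => measurable_fun setT f) (K t).
Proof.
move=> tT i j; apply: (sub_sigma_measurable_fun _ (sub_sigma t tT)).
exact: iterate_measurable.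
Qed.

Local Notation jointly_measurable t f :=
  (mx_entries (fun g : TF t * Z -> R => measurable_fun setT g) f).

Lemma iterate_jointly_measurable t : (t <= T)%N ->
  jointly_measurable t (fun v => K t v.1).
Proof.
move=> tT i j.
exact: (measurableT_comp (iterate_measurable t tT i j) measurable_fst).
Qed.

Lemma estimator_jointly_measurable t : (t <= T)%N ->
  jointly_measurable t (fun v => Ghor p h alpha (K t v.1) v.2.1 v.2.2).
Proof.
move=> tT; apply: (mx_entries_Ghor (function_subring_measurable _)).
- exact: iterate_jointly_measurable.
- move=> i j; exact: (measurableT_comp (measurable_sample1 i j) measurable_snd).
- move=> i j; exact: (measurableT_comp (measurable_sample2 i j) measurable_snd).
Qed.

Local Notation ae_bounded := (mx_entries (fun f : Omega -> R => exists c, {ae P, forall w, `|f w| <= c})).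

Let sample_ae t : (t < T)%N ->
  {ae P, forall w, frob (x t w : 'cV[R]_n) <= DX} /\
  {ae P, forall w, frob (U t w : 'M[R]_(m, n)) = 1}.
Proof.
move=> tT; split.
  apply: (ae_law _ D _ (fun v => frob (v : 'cV[R]_n) <= DX)).
  - exact: (spg_meas_x run).
  - exact: (spg_law_x run).
  - by case: pA.
apply: (ae_law _ s _ (fun v => frob (v : 'M[R]_(m, n)) = 1)).
- exact: (spg_meas_U run).
- exact: (spg_law_U run).
- exact: uniform_on_sphere_ae.
Qed.

Let estimator_ae_bounded_of t : (t < T)%N -> ae_bounded (K t) -> ae_bounded (G t).
Proof.
move=> tT bK; have [xD U1] := sample_ae t tT.
apply: (mx_entries_Ghor (function_subring_ae_bounded _)) => // i j.
- exists DX; apply: ae_imply xD => w; apply: le_trans; exact: coord_le_frob.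
- exists 1; apply: ae_imply U1 => w <-; exact: coord_le_frob.
Qed.

Lemma iterate_ae_bounded t : (t <= T)%N -> ae_bounded (K t).
Proof.
have subB := function_subring_ae_bounded (R := R) P.
elim: t => [_ i j|t IH tT].
  exists `|K0 i j|; apply: aeW => w.
  by rewrite (spg_init run).
have bK := IH (ltnW tT).
have : ae_bounded (fun w => K t w - eta t *: G t w).
  apply: (mx_entriesB subB) => //; apply: (mx_entriesZ subB (fun=> eta t)).
    exact: (fsubring_cst _ subB).
  exact: estimator_ae_bounded_of.
move=> H i j; have [c Hc] := H i j; exists c; apply: ae_imply Hc => w.
by rewrite (spg_step run).
Qed.

Lemma estimator_ae_bounded t : (t < T)%N -> ae_bounded (G t).
Proof. by move=> tT; apply: estimator_ae_bounded_of => //; apply: iterate_ae_bounded; exact: ltnW. Qed.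

(* Conditioning on [F t] amounts to averaging over the fresh sample with the
   iterate frozen. *)
Lemma cond_exp_sample t (g : TF t * Z -> R) : (t < T)%N ->
  measurable_fun setT g ->
  (exists c, {ae P, forall w, `|g (w, sample t w)| <= c}) ->
  {ae P, forall w, cond_exp P (F t) (fun w => g (w, sample t w)) w =
                   \int[(D \x s)%E]_z g (w, z)}.
Proof.
move=> tT mg [c gc].
apply: (cond_exp_freezing P (D \x s)%E (F t) (sample t)) => //.
- exact: sub_sigma (ltnW tT).
- exact: measurable_sample.
- exact: sample_indep.
- apply: (ae_bounded_integrable _ _ c) => //.
  have mj : measurable_fun setT (fun w : Omega => ((w, sample t w) : TF t * Z)).
    apply: measurable_fun_pair; last exact: measurable_sample.
    move=> _ E /(measurable_sub_sigma _ (sub_sigma t (ltnW tT))) FE; rewrite setTI.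
    by have [_] := sub_sigma t (ltnW tT); apply.
  exact: (measurableT_comp mg mj).
Qed.

Lemma integral_sample t (g : TF t * Z -> \bar R) : (t < T)%N ->
  measurable_fun setT g -> (forall v, 0 <= g v)%E ->
  (\int[P]_w g (w, sample t w) = \int[P]_w \int[(D \x s)%E]_z g (w, z))%E.
Proof.
move=> tT; apply: (ge0_integral_freezing P (D \x s)%E (F t) (sample t)).
- exact: sub_sigma (ltnW tT).
- exact: measurable_sample.
- exact: sample_indep.
Qed.

Lemma measurable_integral_sample t (g : TF t * Z -> \bar R) : (t < T)%N ->
  measurable_fun setT g -> (forall v, 0 <= g v)%E ->
  measurable_fun setT (fun w : Omega => \int[(D \x s)%E]_z g (w, z))%E.
Proof.
move=> tT; apply: (measurable_ge0_integral_freezing (D \x s)%E (F t)).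
exact: sub_sigma (ltnW tT).
Qed.

End spg.

(** * Conditional estimates and high-probability levels for the iterates *)

Section spg_guarantees.
Context {R : realType} {n m : nat} {d : measure_display} {Omega : measurableType d}.
Variables (p : lqr R n m) (DX fstar mu : R) (L r : R -> R)
  (s : probability (borel_mx R m n) R).
Variables (P : probability Omega R) (h : nat) (alpha : R) (K0 : 'M[R]_(m, n))
  (eta : nat -> R) (T : nat) (F : nat -> set (set Omega))
  (x : nat -> Omega -> borel_mx R n 1) (U : nat -> Omega -> borel_mx R m n)
  (K : nat -> Omega -> 'M[R]_(m, n)).
Hypotheses (pA : lqr_assumptions p DX) (pmin : is_min_cost p fstar)
  (sU : uniform_on_sphere s) (land : landscape_constants p fstar mu L r)
  (run : spg_run p s P h alpha K0 eta T F x U K).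
Local Notation D := (lqrD p).
Local Notation Z := (borel_mx R n 1 * borel_mx R m n)%type.
Local Notation TF t := (g_sigma_algebraType (F t)).
Local Notation gap := (gap p fstar).
Local Notation grad := (grad_cost p).
Variables (Dl b M : R).
Hypotheses (Dl0 : 0 < Dl) (M0 : 0 < M).
Hypothesis estM : forall K', (gap K' <= Dl%:E)%E ->
  {ae (D \x s)%E, forall z, frob (Ghor p h alpha K' z.1 z.2) <= M}.
Hypothesis estb : forall K', (gap K' <= Dl%:E)%E ->
  frob (mx_mean (D \x s)%E (fun z => Ghor p h alpha K' z.1 z.2) - grad K') <= b.

Let G t w := Ghor p h alpha (K t w) (x t w) (U t w).

Let Gfrozen t (v : TF t * Z) := Ghor p h alpha (K t v.1) v.2.1 v.2.2.

Let measurable_sqnorm t : (t <= T)%N ->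
  measurable_fun setT (fun v : TF t * Z => frob (Gfrozen t v) ^+ 2).
Proof.
move=> tT; under eq_fun do rewrite sqr_frob.
have mG := estimator_jointly_measurable _ _ _ _ _ _ _ _ _ _ _ _ run t tT.
exact: (fsubring_mxdot (function_subring_measurable _) _ _ mG mG).
Qed.

Let bounded_event t : set (TF t * Z) := [set v | frob (Gfrozen t v) <= M].

Let measurable_bounded_event t : (t <= T)%N -> measurable (bounded_event t).
Proof.
move=> tT.
rewrite (_ : bounded_event t =
    setT `&` (fun v => frob (Gfrozen t v) ^+ 2) @^-1` [set` `]-oo, M ^+ 2]]).
  exact: measurable_sqnorm.
rewrite setTI; apply/seteqP; split => v /=; rewrite in_itv/=.
  by move=> vM; rewrite ler_pXn2r// nnegrE ?frob_ge0// ltW.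
by rewrite ler_pXn2r// nnegrE ?frob_ge0// ltW.
Qed.

(** Each conditional quantity is an average over a fresh sample with the policy frozen at [K t w],
    where the bounds for a fixed policy apply. The norm bound holds for almost every sample, so the
    conditional probability is 1. *)
Lemma conditional_estimates t : (t < T)%N ->
  {ae P, forall w, (gap (K t w) <= Dl%:E)%E ->
    [/\ frob (cond_exp_mx P (F t) (G t) w - grad (K t w)) <= b,
        cond_exp P (F t) (fun w' => frob (G t w') ^+ 2) w <= M ^+ 2
      & 1 <= cond_prob P (F t) [set w' | frob (G t w') <= M] w]}.
Proof.
move=> tT; have tT' := ltnW tT.
have mG := estimator_jointly_measurable _ _ _ _ _ _ _ _ _ _ _ _ run t tT'.
have bG := estimator_ae_bounded _ _ _ _ _ _ _ _ _ _ _ _ _ pA sU run t tT.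
have CE := cond_exp_sample _ _ _ _ _ _ _ _ _ _ _ _ run t.
(* There are finitely many entries, so one null set serves them all. *)
have mean_ae : {ae P, forall w ij, cond_exp P (F t) (fun w' => G t w' ij.1 ij.2) w =
    \int[(D \x s)%E]_z Gfrozen t (w, z) ij.1 ij.2}.
  apply: filter_forall => -[i j].
  by apply: (CE (fun v => Gfrozen t v i j)) => //; exact: mG.
have sq_ae : {ae P, forall w, cond_exp P (F t) (fun w' => frob (G t w') ^+ 2) w =
    \int[(D \x s)%E]_z frob (Gfrozen t (w, z)) ^+ 2}.
  apply: (CE (fun v => frob (Gfrozen t v) ^+ 2)) => //.
    exact: measurable_sqnorm.
  have [c Hc] := fsubring_mxdot (function_subring_ae_bounded P) _ _ bG bG.
  by exists c; apply: filterS Hc => w; rewrite -sqr_frob.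
have ind_ae : {ae P, forall w, cond_prob P (F t) [set w' | frob (G t w') <= M] w =
    \int[(D \x s)%E]_z \1_(bounded_event t) (w, z)}.
  apply: (CE (\1_(bounded_event t))) => //.
    by apply: measurable_indic; exact: measurable_bounded_event.
  by exists 1; apply: aeW => w; rewrite indicE; case: (_ \in _); rewrite ?normr1 ?normr0.
apply: (ae_imply2 _ _ _ _ _ (filterI mean_ae sq_ae) ind_ae) => w [mw sw] iw Kw.
have GM := estM _ Kw.
have mK : mx_entries (fun f : Z -> R => measurable_fun setT f)
    (fun z => Ghor p h alpha (K t w) z.1 z.2).
  exact: measurable_Ghor_sample.
split.
- have -> : cond_exp_mx P (F t) (G t) w =
      mx_mean (D \x s)%E (fun z => Ghor p h alpha (K t w) z.1 z.2).
    by apply/matrixP => i j; rewrite !mxE (mw (i, j)).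
  exact: estb.
- rewrite sw -[leRHS](Rintegral_prob_cst (D \x s)%E); apply: ae_le_Rintegral.
  + apply: (ae_bounded_integrable _ _ (M ^+ 2)).
      under eq_fun do rewrite sqr_frob.
      exact: (fsubring_mxdot (function_subring_measurable _)).
    apply: ae_imply GM => z zM; rewrite ger0_norm ?sqr_ge0//.
    by rewrite ler_pXn2r// nnegrE ?frob_ge0// ltW.
  + exact: integrable_cst.
  + apply: ae_imply GM => z zM.
    by rewrite ler_pXn2r// nnegrE ?frob_ge0// ltW.
- rewrite iw -[leLHS](Rintegral_prob_cst (D \x s)%E); apply: ae_le_Rintegral.
  + exact: integrable_cst.
  + apply: (ae_bounded_integrable _ _ 1).
      apply: (measurableT_comp (measurable_indic (measurable_bounded_event t tT'))).
      exact: measurable_pair1.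
    by apply: aeW => z; rewrite indicE; case: (_ \in _); rewrite ?normr1 ?normr0.
  + by apply: ae_imply GM => z zM; rewrite indicE mem_set.
Qed.

Variables (eps theta C0 u : R) (N : nat).
Let GD := 2 * Num.sqrt (L Dl * Dl).
Let a := 2 * L Dl * M ^+ 2 / mu ^+ 2.
Hypotheses (N4 : (4 <= N)%N) (eps0 : 0 < eps) (u0 : 0 <= u)
  (etaE : forall t, (t < T)%N -> eta t = 2 / (mu * (N + t)%:R))
  (etaM : 2 / (mu * N%:R) * M <= r Dl)
  (bGD : GD * b <= mu * eps / 8)
  (thetaE : theta = mu / (16 * (M + GD) ^+ 2)) (C0a : 3 * a <= C0).

(** The gap at which the exponent of [phi t] equals [theta * u]. *)
Let level t : R := eps / 2 + (C0 + u) / ((N + t)%:R - 1).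

Hypotheses (level_lt : forall t, level t < Dl)
  (start : (gap K0 <= (eps / 2 + C0 / (N%:R - 1))%:E)%E).

Let good t : set Omega := [set w | forall k, (k <= t)%N -> (gap (K k w) <= (level k)%:E)%E].

Let weight_gt0 t : 0 < (N + t)%:R - 1 :> R.
Proof. by rewrite subr_gt0 ltr1n (leq_trans _ (leq_addr _ _))// (leq_trans _ N4). Qed.

Let mu0 : 0 < mu. Proof. exact: mu_gt0 land. Qed.

Let theta_ge0 : 0 <= theta.
Proof.
rewrite thetaE; apply: divr_ge0; first exact: ltW.
by rewrite mulr_ge0// sqr_ge0.
Qed.

Let good_sub_sigma t : (t <= T)%N -> F t (good t).
Proof.
move=> tT.
have sublevel k : (k <= T)%N -> F k [set w | (gap (K k w) <= (level k)%:E)%E].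
  move=> kT; have sF := spg_sub_sigma run kT.
  apply/(measurable_sub_sigma _ sF).
  have mgap : measurable_fun setT (fun w : TF k => gap (K k w)).
    apply: emeasurable_funB => //; apply: (measurable_cost _ _ pA).
    exact: (iterate_measurable _ _ _ _ _ _ _ _ _ _ _ _ run).
  by have := emeasurable_fun_infty_c measurableT mgap (level k)%:E; rewrite setTI.
elim: t tT => [|t IH] tT.
  rewrite (_ : good 0 = [set w | (gap (K 0%N w) <= (level 0)%:E)%E]); first exact: sublevel.
  by apply/seteqP; split => [w /(_ 0%N)|w H k]; [exact|rewrite leqn0 => /eqP ->].
have sF := spg_sub_sigma run tT.
rewrite (_ : good t.+1 = good t `&` [set w | (gap (K t.+1 w) <= (level t.+1)%:E)%E]).
  apply/(measurable_sub_sigma _ sF); apply: measurableI; apply/(measurable_sub_sigma _ sF).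
    by apply: (spg_filtration run) => //; exact/IH/ltnW.
  exact: sublevel.
apply/seteqP; split => [w H|w [H1 H2] k].
  by split => [k kt|]; apply: H => //; exact: leqW.
by rewrite leq_eqVlt => /orP[/eqP -> //|]; rewrite ltnS; exact: H1.
Qed.

Let measurable_good t : (t <= T)%N -> measurable (good t).
Proof. by move=> tT; have [_] := spg_sub_sigma run tT; apply; exact: good_sub_sigma. Qed.

Let phi t w := potential p fstar eps theta C0 ((N + t)%:R - 1) (K t w).

Let measurable_phi t : (t <= T)%N -> measurable_fun setT (phi t).
Proof.
move=> tT; apply: (measurable_potential _ _ _ pA).
exact: (iterate_measurable_ambient _ _ _ _ _ _ _ _ _ _ _ _ run).
Qed.

(** [good t] belongs to [F t], so its indicator is frozen together with the iterate. On it the gap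
    is below [Dl] and [potential_step] applies pointwise; off it both integrands vanish. *)
Let phi_step t : (t < T)%N ->
  (\int[P]_(w in good t) phi t.+1 w <= 1 + \int[P]_(w in good t) phi t w)%E.
Proof.
move=> tT; have tT' := ltnW tT; have sF := spg_sub_sigma run tT'.
have mgood := measurable_good t tT'.
(* [potential_step] passes from weight [q - 1] to weight [q]; with [q = N + t] these are the weights
   of [phi t] and [phi t.+1]. *)
have weightS : (N + t.+1)%:R - 1 = (N + t)%:R :> R by rewrite addnS -natr1 addrK.
pose next (v : TF t * Z) := K t v.1 - eta t *: Gfrozen t v.
have subM := @function_subring_measurable R _ (TF t * Z)%type.
have mnext : mx_entries (fun f : TF t * Z -> R => measurable_fun setT f) next.
  apply: (mx_entriesB subM).
    exact: (iterate_jointly_measurable _ _ _ _ _ _ _ _ _ _ _ _ run).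
  apply: (mx_entriesZ subM (fun=> eta t)); first exact: measurable_cst.
  exact: (estimator_jointly_measurable _ _ _ _ _ _ _ _ _ _ _ _ run).
(* As [0 * +oo = 0], this vanishes off [good t] even where the potential is infinite. *)
pose g (v : TF t * Z) : \bar R :=
  ((\1_(good t) v.1 : R)%:E * potential p fstar eps theta C0 (N + t)%:R (next v))%E.
have mg : measurable_fun setT g.
  apply: emeasurable_funM; last exact: (measurable_potential _ _ _ pA).
  apply/measurable_EFinP.
  have mg1 : measurable_fun setT (\1_(good t) : TF t -> R).
    by apply: measurable_indic; apply/(measurable_sub_sigma _ sF); exact: good_sub_sigma.
  exact: (measurableT_comp mg1 measurable_fst).
have g0 v : (0 <= g v)%E by rewrite mule_ge0 ?lee_fin// potential_ge0.
have frozen : (\int[P]_(w in good t) phi t.+1 w = \int[P]_w g (w, (x t w, U t w)))%E.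
  rewrite integral_mkcond; apply: eq_integral => w _.
  rewrite patchE /g indicE /phi weightS (spg_step run tT).
  by case: (w \in good t); rewrite ?mul1e ?mul0e.
rewrite [leLHS]frozen [leLHS](integral_sample _ _ _ _ _ _ _ _ _ _ _ _ run _ _ tT mg g0).
have mphi := measurable_phi t tT'.
have phi_ge0 w : (0 <= phi t w)%E by exact: potential_ge0.
apply: (@le_trans _ _ (\int[P]_(w in good t) (1 + phi t w))%E); last first.
  rewrite ge0_integralD//; last exact: measurable_funTS.
  by apply: leeD2r; rewrite integral_cst//= mul1e; exact: probability_le1.
rewrite [leRHS]integral_mkcond; apply: ge0_le_integral => //.
- by move=> w _; exact: integral_ge0.
- exact: (measurable_integral_sample _ _ _ _ _ _ _ _ _ _ _ _ run _ _ tT mg g0).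
- apply/(measurable_restrictT _ _).1 => //.
  by apply: measurable_funTS; exact: emeasurable_funD.
move=> w _; rewrite patchE; case: ifPn => [wgood|wbad]; last first.
  rewrite [leLHS](_ : _ = 0%E)//; apply: integral0_eq => z _.
  by rewrite /g/= indicE (negbTE wbad) mul0e.
have Kw : (gap (K t w) < Dl%:E)%E.
  have /set_mem/(_ t (leqnn t)) := wgood.
  by move=> /le_lt_trans; apply; rewrite lte_fin.
rewrite (eq_integral (fun z : Z => potential p fstar eps theta C0 (N + t)%:R
    (K t w - eta t *: Ghor p h alpha (K t w) z.1 z.2))); last first.
  by move=> z _; rewrite /g/= indicE wgood mul1e.
rewrite etaE//; apply: (potential_step _ _ _ _ _ _ pA pmin land _ _ _ Dl b M) => //.
- by rewrite ler1n (leq_trans _ (leq_addr _ _))// (leq_trans _ N4).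
- apply: le_trans etaM; rewrite ler_pM2r// ler_pM2l// lef_pV2 ?posrE.
  + by rewrite ler_pM2l ?mu0// ler_nat leq_addr.
  + by rewrite mulr_gt0 ?mu0// ltr0n (leq_trans _ (leq_addr _ _))// (leq_trans _ N4).
  + by rewrite mulr_gt0 ?mu0// ltr0n (leq_trans _ N4).
- exact: measurable_Ghor_sample.
- exact: estM (ltW Kw).
- exact: estb (ltW Kw).
Qed.

(** [escape_probability] with threshold [exp (theta u)], the value of the potential at each
    level. *)
Lemma iterates_below_levels :
  exists E : set Omega, [/\ measurable E,
    forall w, E w -> forall t, (t <= T)%N -> (gap (K t w) <= (level t)%:E)%E
    & ((1 - (T.+1)%:R * expR (- (theta * u)))%:E <= P E)%E].
Proof.
exists (good T); split; [exact: measurable_good|by move=> w|].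
have Lam0 := expR_gt0 (theta * u).
have wN : 0 < N%:R - 1 :> R by have := weight_gt0 0; rewrite addn0.
have : ((expR (theta * u))%:E * P (~` good T) <= (T.+1)%:R%:E)%E.
  apply: (escape_probability P good phi _ T (ltW Lam0) measurable_good measurable_phi).
  - by move=> t w; exact: potential_ge0.
  - apply/seteqP; split => // w _ k; rewrite leqn0 => /eqP ->.
    rewrite (spg_init run); apply: le_trans start _; rewrite lee_fin lerD2l addn0.
    by rewrite ler_pM2r ?lerDl// invr_gt0.
  (* By [start] the initial exponent is nonpositive. *)
  - move=> w; rewrite /phi (spg_init run) potential_fin; last first.
      exact: (gap_fin_num _ _ pmin _ _ start).
    rewrite lee_fin -[leRHS]expR0 ler_expR addn0 mulr_ge0_le0// subr_le0.
    rewrite -ler_pdivlMl//.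
    rewrite lerBlDl [_^-1 * C0]mulrC; exact: (fine_gap_le _ _ pmin _ _ start).
  - by move=> t _ w H k kt; apply: H; exact: leqW.
  (* At the first exit the level at [t.+1] itself is exceeded; an infinite gap gives an infinite
     potential. *)
  - move=> t w tT Et nEt1.
    have nlevel : ~~ (gap (K t.+1 w) <= (level t.+1)%:E)%E.
      apply/negP => Kt; apply: nEt1 => k; rewrite leq_eqVlt => /orP[/eqP -> //|].
      by rewrite ltnS; exact: Et.
    have gKge0 := gap_ge0 _ _ pmin (K t.+1 w).
    case gK: (gap (K t.+1 w)) => [y| |].
    + rewrite /phi potential_fin ?gK//= lee_fin ler_expR ler_wpM2l//.
      move: nlevel; rewrite gK lee_fin -ltNge /level -ltrBrDl ltr_pdivrMr// => h1.
      by rewrite lerBrDl mulrC ltW.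
    + by rewrite /phi potential_pinfty// leey.
    + by rewrite gK in gKge0.
  - exact: phi_step.
have mgT := measurable_good T (leqnn T).
rewrite probability_setC// -[P _]fineK ?fin_num_measure//.
rewrite -EFinB -EFinM !lee_fin => HH.
rewrite lerBlDr addrC -lerBlDr expRN ler_pdivlMr//.
by rewrite mulrC.
Qed.

End spg_guarantees.

(** * Numerical consequences of the choice of parameters *)

Section parameter_arithmetic.
Context {R : realType}.

Lemma ge_absz_ceil (y : R) : y <= `|Num.ceil y|%N%:R.
Proof.
have := lexx (Num.ceil y); rewrite ceil_le_int => /le_trans; apply.
by rewrite -[`|_|%N%:R]/((`|Num.ceil y|%N : int)%:~R) abszE ler_int ler_norm.
Qed.

Lemma ge_absz_max_ceil (y : R) : y <= `|(Num.max 1 (Num.ceil y))%R|%N%:R.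
Proof.
have := lexx (Num.ceil y); rewrite ceil_le_int => /le_trans; apply.
rewrite -[`|_|%N%:R]/((`|(Num.max 1 (Num.ceil y))%R|%N : int)%:~R) abszE ler_int.
by apply: le_trans (ler_norm _); rewrite le_max lexx orbT.
Qed.

(** From [(1 - lam)^h <= exp (- lam h) <= 1 / y]. *)
Lemma geometric_decay (lam y : R) (h : nat) : 0 < lam -> lam <= 1 -> 0 < y ->
  lam^-1 * ln y <= h%:R -> (1 - lam) ^+ h * y <= 1.
Proof.
move=> lam0 lam1 y0 hy.
have : (1 - lam) ^+ h <= expR (- ln y).
  apply: (@le_trans _ _ (expR (- lam) ^+ h)).
    by apply: lerXn2r; rewrite ?nnegrE ?subr_ge0 ?expR_ge0// expR_ge1Dx.
  rewrite -expRM_natl ler_expR mulrN lerN2 mulrC -ler_pdivrMl//.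
rewrite expRN lnK ?posrE// => hy'.
by rewrite -ler_pdivlMr// div1r.
Qed.

(** The two arguments of the maximum are the ratios of the prefactor of [y] to the two targets: the
    first for the norm bound, the second for the bias. *)
Lemma truncation_small (dim f2 DX al lt mu eps GD y : R) :
  0 < dim -> 0 < f2 -> 0 < DX -> 0 < al -> 0 < lt -> 0 < mu -> 0 < eps -> 0 < GD ->
  0 <= y ->
  y * Num.max (f2 * DX ^+ 2 / (2 * al * lt))
              (8 * dim * f2 * DX ^+ 2 * GD / (al * mu * eps)) <= 1 ->
  dim * f2 * DX ^+ 2 / (2 * al) * y <= dim * lt /\
  dim * f2 * DX ^+ 2 / (2 * al) * y <= mu * eps / (16 * GD).
Proof.
move=> dim0 f20 DX0 al0 lt0 mu0 eps0 GD0 y0; rewrite maxr_pMr// ge_max => /andP[h1 h2].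
split.
  have -> : dim * f2 * DX ^+ 2 / (2 * al) * y =
      dim * lt * (y * (f2 * DX ^+ 2 / (2 * al * lt))).
    by field; rewrite !gt_eqF.
  by rewrite ler_piMr// mulr_ge0// ltW.
have -> : dim * f2 * DX ^+ 2 / (2 * al) * y =
    mu * eps / (16 * GD) * (y * (8 * dim * f2 * DX ^+ 2 * GD / (al * mu * eps))).
  by field; rewrite !gt_eqF.
by rewrite ler_piMr// divr_ge0// mulr_ge0// ltW.
Qed.

(** The left-hand side is [3 a + u]. Since [6 <= 8] and, by [mu <= 2 L], [16 mu <= 32 L <= 6144 L],
    the constant [D] covers both terms. *)
Lemma noise_budget (L mu M GD lg : R) : 0 < mu -> mu <= 2 * L -> 0 <= lg ->
  3 * (2 * L * M ^+ 2 / mu ^+ 2) + lg / (mu / (16 * (M + GD) ^+ 2)) <=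
  8 * L / mu ^+ 2 * (M ^+ 2 + 768 * (M + GD) ^+ 2 * lg).
Proof.
move=> mu0 muL lg0; set G2 := (M + GD) ^+ 2.
have G20 : 0 <= G2 by exact: sqr_ge0.
have -> : lg / (mu / (16 * G2)) = mu * (16 * (lg * G2)) / mu ^+ 2.
  (* For [G2 = 0] both sides are 0, because the inverse of 0 is 0. *)
  have [->|G2n] := eqVneq G2 0; first by rewrite !(mulr0, invr0, mul0r).
  by field; rewrite gt_eqF.
have -> : 3 * (2 * L * M ^+ 2 / mu ^+ 2) = 6 * L * M ^+ 2 / mu ^+ 2 by rewrite !mulrA -natrM.
have -> : 8 * L / mu ^+ 2 * (M ^+ 2 + 768 * G2 * lg) =
   (8 * L * M ^+ 2 + 6144 * L * (lg * G2)) / mu ^+ 2.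
  by field; rewrite gt_eqF.
rewrite -mulrDl ler_pM2r ?invr_gt0 ?exprn_gt0//.
have p0 : 0 <= lg * G2 by rewrite mulr_ge0.
have L0 : 0 <= L by lra.
have h1 : mu * (16 * (lg * G2)) <= 2 * L * (16 * (lg * G2)).
  by rewrite ler_wpM2r// mulr_ge0.
have h2 : 0 <= L * M ^+ 2 by rewrite mulr_ge0 ?sqr_ge0.
have h3 : 0 <= L * (lg * G2) by rewrite mulr_ge0.
lra.
Qed.

(** [c <= 2 q D0 <= 3 (q - 1) D0] as [q >= 4], so every level is at most [7 / 2 D0]. *)
Lemma level_bound (eps D0 Dn c N q : R) : 0 < D0 -> eps <= D0 -> 4 <= N -> N <= q ->
  Dn <= N * D0 -> c <= N * D0 + Dn -> eps / 2 + c / (q - 1) < 6 * D0.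
Proof.
move=> D00 eD N4 Nq DnN cD.
have q1 : 0 < q - 1 by lra.
have : c / (q - 1) <= 3 * D0.
  rewrite ler_pdivrMr//.
  have : N * D0 <= q * D0 by rewrite ler_pM2r.
  have : 4 * D0 <= q * D0 by rewrite ler_pM2r//; lra.
  by rewrite mulrBr mulr1; lra.
lra.
Qed.

Lemma final_level (eps C c N t : R) : 0 < eps -> 1 <= N -> 1 <= t -> 0 <= c ->
  2 * C / eps <= t -> c <= C / 2 -> eps / 2 + c / (N + t - 1) <= eps.
Proof.
move=> e0 N1 t1 c0; rewrite ler_pdivrMr// => Ct cC.
have q0 : 0 < N + t - 1 by lra.
have : c / (N + t - 1) <= eps / 2.
  rewrite ler_pdivrMr//.
  have : 0 <= (N - 1) * eps by rewrite mulr_ge0 ?subr_ge0// ltW.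
  lra.
lra.
Qed.

End parameter_arithmetic.

Theorem corollary4p1 (R : realType) (n m : nat) (p : lqr R n m) (DX fstar : R)
  (s : probability (borel_mx R m n) R) (mu : R) (L r l : R -> R)
  (K0 : 'M[R]_(m, n)) (eps delta : R)
  (Dl f2 GD lmin dim alpha epsh b V M : R) (h : nat)
  (D C : R) (N : nat) :
  lqr_assumptions p DX ->
  is_min_cost p fstar ->
  uniform_on_sphere s ->
  landscape_constants p fstar mu L r ->
  estimator_constants p s fstar L r l ->
  stable p K0 ->
  Dl = 6 * fine (gap p fstar K0) ->
  f2 = fstar + 2 * Dl ->
  GD = 2 * Num.sqrt (L Dl * Dl) ->
  lmin = lambda_min (lqrQ p) ->
  dim = (m * n)%:R ->
  0 < eps -> eps <= fine (gap p fstar K0) ->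
  0 < delta -> delta < 1 ->
  delta <= (mu * eps / (16 * GD * dim * l Dl)) ^+ 2 ->
  alpha = Num.min (r Dl) (mu * eps / (16 * GD * L Dl)) ->
  h = `|(Num.max 1 (Num.ceil (f2 / lmin *
         ln (Num.max (f2 * DX ^+ 2 / (2 * alpha * l Dl))
                     (8 * dim * f2 * DX ^+ 2 * GD / (alpha * mu * eps))))))%R|%N ->
  epsh = dim * f2 * DX ^+ 2 / (2 * alpha) * (1 - lmin / f2) ^+ h ->
  b = L Dl * alpha + epsh ->
  V = 4 * dim ^+ 2 * l Dl ^+ 2 ->
  M = 2 * dim * l Dl ->
  D = 8 * L Dl / mu ^+ 2 * (M ^+ 2 + 768 * (M + GD) ^+ 2 * ln (1 / delta)) ->
  N = `|(Num.ceil (Num.max 4 (Num.max (2 * M / (mu * r Dl))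
                                     (D / fine (gap p fstar K0)))))%R|%N ->
  C = 2 * (N%:R * fine (gap p fstar K0) + D) ->
  b <= mu * eps / (8 * GD) /\
  forall (d : measure_display) (Omega : measurableType d)
    (P : probability Omega R) (eta : nat -> R) (T : nat)
    (F : nat -> set (set Omega))
    (x : nat -> Omega -> borel_mx R n 1) (U : nat -> Omega -> borel_mx R m n)
    (K G : nat -> Omega -> 'M[R]_(m, n)),
  spg_run p s P h alpha K0 eta T F x U K ->
  (forall t w, G t w = Ghor p h alpha (K t w) (x t w) (U t w)) ->
  (forall t, (t < T)%N ->
     {ae P, forall w, (gap p fstar (K t w) <= Dl%:E)%E ->
       [/\ frob (cond_exp_mx P (F t) (G t) w - grad_cost p (K t w)) <= b,
           cond_exp P (F t) (fun w' => frob (G t w') ^+ 2) w <= V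
         & 1 - delta <= cond_prob P (F t) [set w' | frob (G t w') <= M] w]}) /\
  ((forall t, (t < T)%N -> eta t = 2 / (mu * (N + t)%:R)) ->
   Num.max 1 (2 * C / eps) <= T%:R ->
   with_prob_at_least P (1 - 2 * T%:R * delta)
     [set w | (gap p fstar (K T w) <= eps%:E)%E /\
              forall t, (t <= T)%N -> stable p (K t w)]).
Proof.
move=> pA pmin sU land est _ DlE f2E GDE lminE dimE eps0 epsD delta0 delta1 delta_le.
move=> alphaE hE epshE bE VE ME DE NE CE.
set D0 := fine (gap p fstar K0) in DlE epsD NE CE.
have D00 : 0 < D0 by exact: lt_le_trans epsD.
have gK0 : gap p fstar K0 = D0%:E.
  by move: D00; rewrite /D0; case: (gap p fstar K0) => //=; rewrite ltxx.
(* In dimension 0 the divisor in the bound on [delta] vanishes, and division by 0 yields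
   [delta <= 0]. *)
have dim0 : 0 < dim.
  rewrite lt0r dimE ler0n andbT -dimE; apply/eqP => dimz.
  by move: delta_le; rewrite dimz mulr0 mul0r invr0 mulr0 expr0n/= leNgt delta0.
have n0 : (0 < n)%N.
  by move: dim0; rewrite dimE ltr0n muln_gt0 => /andP[].
have Dl0 : 0 < Dl by rewrite DlE mulr_gt0.
have mu0 : 0 < mu := mu_gt0 _ _ _ _ _ land.
have L0 : 0 < L Dl := L_gt0 _ _ _ _ _ land _ Dl0.
have r0 : 0 < r Dl := r_gt0 _ _ _ _ _ land _ Dl0.
have l0 : 0 < l Dl by case: (est Dl Dl0).
have GD0 : 0 < GD by rewrite GDE mulr_gt0// sqrtr_gt0 mulr_gt0.
have DX0 : 0 < DX by case: pA.
have alpha0 : 0 < alpha.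
  by rewrite alphaE lt_min r0 divr_gt0// !mulr_gt0.
have alpha_r : alpha <= r Dl by rewrite alphaE ge_min lexx.
have K0lt : (gap p fstar K0 < Dl%:E)%E by rewrite gK0 lte_fin DlE ltr_pMl// ltr1n.
have costK0 : (cost p K0 <= f2%:E)%E.
  rewrite f2E -gap_le_cost gK0 lee_fin DlE; lra.
have lmin0 : 0 < lmin by rewrite lminE; exact: (lmin_gt0 _ _ pA n0).
have lmin_f2 : lmin <= f2 by rewrite lminE; exact: (lmin_le_cost _ _ pA _ _ costK0 n0).
have f20 : 0 < f2 by exact: lt_le_trans lmin_f2.
have lam0 : 0 < lmin / f2 by rewrite divr_gt0.
have lam1 : lmin / f2 <= 1 by rewrite ler_pdivrMr// mul1r.
have M0 : 0 < M by rewrite ME !mulr_gt0.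
have [epsh_dl epsh_mu] : epsh <= dim * l Dl /\ epsh <= mu * eps / (16 * GD).
  rewrite epshE; apply: (truncation_small dim f2 DX alpha (l Dl) mu eps GD) => //.
    by rewrite exprn_ge0// subr_ge0.
  apply: geometric_decay => //.
    by rewrite lt_max divr_gt0// !mulr_gt0// exprn_gt0.
  by rewrite invf_div hE; exact: ge_absz_max_ceil.
have b_small : b <= mu * eps / (8 * GD).
  have : L Dl * alpha <= mu * eps / (16 * GD).
    apply: (@le_trans _ _ (L Dl * (mu * eps / (16 * GD * L Dl)))).
      by rewrite ler_pM2l// alphaE ge_min lexx orbT.
    by rewrite le_eqVlt; apply/orP; left; apply/eqP; field; rewrite !gt_eqF.
  have -> : mu * eps / (8 * GD) = mu * eps / (16 * GD) + mu * eps / (16 * GD).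
    by field; rewrite gt_eqF.
  by rewrite bE => h1; exact: lerD.
split=> [//|d Omega P eta T F x U K G run GE].
have {GE}-> : G = fun t w => Ghor p h alpha (K t w) (x t w) (U t w).
  by apply/funext => t; apply/funext => w; exact: GE.
(* [M = 2 d l]: one [d l] for the infinite-horizon estimator, one for the truncation error. *)
have estM K' : (gap p fstar K' <= Dl%:E)%E ->
    {ae (lqrD p \x s)%E, forall z, frob (Ghor p h alpha K' z.1 z.2) <= M}.
  move=> K'Dl.
  have := Ghor_bounded _ _ _ _ _ _ _ _ pA pmin sU land est n0 _ _ h Dl0 alpha0 alpha_r K' K'Dl.
  apply: ae_imply => z /le_trans; apply.
  by rewrite -dimE -f2E -lminE -epshE ME -mulrA mulr_natl mulr2n lerD2l.
have estb K' : (gap p fstar K' <= Dl%:E)%E ->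
    frob (mx_mean (lqrD p \x s)%E (fun z => Ghor p h alpha K' z.1 z.2) - grad_cost p K') <= b.
  move=> K'Dl; rewrite bE epshE f2E lminE dimE.
  exact: (mean_Ghor_bias _ _ _ _ _ _ _ _ pA pmin sU land est n0 _ _ h Dl0 alpha0 alpha_r K' K'Dl).
split.
  move=> t tT.
  have := conditional_estimates _ _ _ _ _ _ _ _ _ _ _ _ _ _ pA sU run _ _ _ M0 estM estb t tT.
  apply: ae_imply => w H Kw; have [H1 H2 H3] := H Kw; split => //.
    by rewrite VE; apply: le_trans H2 _; rewrite ME !exprMn -natrX.
  by apply: le_trans H3; rewrite lerBlDr lerDl ltW.
move=> etaE; rewrite ge_max => /andP[T1 TC].
have lg0 : 0 <= ln (1 / delta) by rewrite ln_ge0// div1r invf_ge1// ltW.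
pose theta := mu / (16 * (M + GD) ^+ 2).
have MG0 : 0 < (M + GD) ^+ 2 by rewrite exprn_gt0// addr_gt0.
have theta0 : 0 < theta by rewrite divr_gt0// mulr_gt0.
(* Chosen so that [exp (- theta u) = delta]. *)
pose u := ln (1 / delta) / theta.
have u0 : 0 <= u by rewrite divr_ge0// ltW.
pose a := 2 * L Dl * M ^+ 2 / mu ^+ 2.
have a0 : 0 <= a by rewrite divr_ge0 ?sqr_ge0// mulr_ge0 ?sqr_ge0// mulr_ge0// ltW.
(* The first term makes the initial potential at most 1, the second absorbs the noise. *)
pose C0 := N%:R * D0 + 3 * a.
(* The two gradient bounds are compared at [K0], whose gap is positive. *)
have muL : mu <= 2 * L Dl.
  have /andP[lo hi] := grad_bounds _ _ _ _ _ pmin land _ Dl0 _ K0lt.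
  by have := le_trans lo hi; rewrite ler_pM2r.
have D_ge : 3 * a + u <= D by rewrite DE; exact: noise_budget.
have Nmax : Num.max 4 (Num.max (2 * M / (mu * r Dl)) (D / D0)) <= N%:R.
  by rewrite NE; exact: ge_absz_ceil.
move: Nmax; rewrite !ge_max => /and3P[N4 NM ND].
have N4' : (4 <= N)%N by rewrite -(ler_nat R).
have DN : D <= N%:R * D0 by rewrite -ler_pdivrMr.
have C0uD : C0 + u <= N%:R * D0 + D by rewrite /C0 -addrA lerD2l.
have C0u0 : 0 <= C0 + u by rewrite !addr_ge0// mulr_ge0// ltW.
have level_lt t : eps / 2 + (C0 + u) / ((N + t)%:R - 1) < Dl.
  rewrite DlE; apply: (level_bound _ _ D _ N%:R) => //.
  by rewrite ler_nat leq_addr.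
have etaM : 2 / (mu * N%:R) * M <= r Dl.
  have N0 : 0 < N%:R :> R by rewrite ltr0n (leq_trans _ N4').
  rewrite mulrAC ler_pdivrMr; last by rewrite mulr_gt0.
  move: NM; rewrite ler_pdivrMr; last by rewrite mulr_gt0.
  by rewrite (_ : r Dl * (mu * N%:R) = N%:R * (mu * r Dl))//; ring.
have bGD : 2 * Num.sqrt (L Dl * Dl) * b <= mu * eps / 8.
  rewrite -GDE; apply: (@le_trans _ _ (GD * (mu * eps / (8 * GD)))).
    by rewrite ler_pM2l.
  by rewrite le_eqVlt; apply/orP; left; apply/eqP; field; rewrite gt_eqF.
have start : (gap p fstar K0 <= (eps / 2 + C0 / (N%:R - 1))%:E)%E.
  have N1 : 0 < N%:R - 1 :> R by rewrite subr_gt0 ltr1n (leq_trans _ N4').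
  rewrite gK0 lee_fin; apply: (@le_trans _ _ (C0 / (N%:R - 1))); last first.
    by rewrite lerDr divr_ge0// ltW.
  rewrite ler_pdivlMr// mulrBr mulr1 /C0 [D0 * _]mulrC lerD2l.
  by apply: (@le_trans _ _ 0); [rewrite oppr_le0 ltW|exact: mulr_ge0].
have thetaE : theta = mu / (16 * (M + 2 * Num.sqrt (L Dl * Dl)) ^+ 2) by rewrite -GDE.
have C0a : 3 * (2 * L Dl * M ^+ 2 / mu ^+ 2) <= C0.
  by rewrite -/a /C0 lerDr mulr_ge0// ltW.
have [E [mE Elevel PE]] := iterates_below_levels _ _ _ _ _ _ _ _ _ _ _ _ _ _ _ _ _
  pA pmin land run _ _ _ Dl0 M0 estM estb _ _ _ _ _ N4' eps0 u0 etaE etaM bGD thetaE C0a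
  level_lt start.
exists E; split => //.
  move=> w Ew; split.
    apply: le_trans (Elevel w Ew T (leqnn T)) _; rewrite lee_fin natrD.
    apply: (final_level _ C) => //.
    - by apply: le_trans N4; rewrite ler1n.
    - by rewrite CE mulrC mulKf.
  move=> t tT; apply: (stable_of_gap _ _ _ _ _ land _ Dl0).
  by apply: le_lt_trans (Elevel w Ew t tT) _; rewrite lte_fin.
apply: le_trans PE; rewrite lee_fin lerD2l lerN2.
have -> : expR (- (theta * u)) = delta.
  by rewrite /u mulrC mulfVK ?gt_eqF// div1r lnV ?posrE// opprK lnK.
(* [T + 1 <= 2 T] because [T >= 1]. *)
rewrite ler_pM2r// -natr1 mulr_natl mulr2n lerD2l.
exact: T1.
Qed.
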